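(* Let $\mathcal{K}$ be a directed $2$-complex, $p$ a nonempty $1$-path in $\mathcal{K}$, $\nu$ a function from the edges of $\mathcal{K}$ to a set of (possibly infinite) cardinals, $\mathcal{K}_\nu$ the corresponding expansion, $\widetilde{\mathcal{K}}_p$ the universal $2$-cover of $\mathcal{K}$ with base $p$, with root $\tilde p$ and labelling map $\phi$, and let $\mathcal{A}$ be the kernel of the natural retraction $\theta\colon\mathcal{D}(\mathcal{K}_\nu,p)\to\mathcal{D}(\mathcal{K},p)$. (1) For every edge $\tilde e$ of $\widetilde{\mathcal{K}}_p$, let $G_{\tilde e}$ be the free group of rank $\nu(e)$, where $e=\phi(\tilde e)$. Then $\mathcal{A}$ is a graph product of the free groups $G_{\tilde e}$ over the independence graph $\Gamma(\widetilde{\mathcal{K}}_p,\tilde p)$. Thus $\mathcal{A}$ has a partially commutative presentation whose generators are symbols $a(\tilde e,i)$, with $\tilde e$ an edge of $\widetilde{\mathcal{K}}_p$ and $1\le i\le\nu(e)$ (i.e. $i$ in an index set of cardinality $\nu(e)$), $e=\phi(\tilde e)$, and whose defining relations are $[a(\tilde e_1,i_1),a(\tilde e_2,i_2)]=1$ with $\tilde e_1,\tilde e_2$ independent edges of $\widetilde{\mathcal{K}}_p$. (2) As an element of $\mathcal{D}(\mathcal{K}_\nu,p)$, the symbol $a(\tilde e,i)$ is represented by a diagram of the form $\Delta^{-1}\Psi\Delta$ over $\mathcal{K}_\nu$, where $\Delta=\phi(\widetilde\Delta)$ for some diagram $\widetilde\Delta$ over $\widetilde{\mathcal{K}}_p$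 with $\lfloor\widetilde\Delta\rfloor=\tilde p$ and $\lceil\widetilde\Delta\rceil=\tilde q'\tilde e\tilde q''$ for some $\tilde q',\tilde q''$, and $\Psi$ is the atomic diagram $\varepsilon(q')+f_i+\varepsilon(q'')$, where $q'=\phi(\tilde q')$, $q''=\phi(\tilde q'')$ and $f_i$ is the $i$-th leaf attached to $e=\phi(\tilde e)$. This element is independent of the choice of $\widetilde\Delta$. (3) For every diagram $\Gamma\in\mathcal{D}(\mathcal{K},p)$ and every element $a(\tilde e,i)$ represented by $\Delta^{-1}\Psi\Delta$ as in part (2), let $\bar\Delta$ be the lift of the diagram $\Delta\Gamma$ over $\mathcal{K}$ to $\widetilde{\mathcal{K}}_p$, and let $\bar e$ be the edge of $\lceil\bar\Delta\rceil$ that is the lift of the occurrence of $e=\phi(\tilde e)$ in $q'eq''=\lceil\Delta\Gamma\rceil$. Then $\Gamma^{-1}a(\tilde e,i)\Gamma$ is equal to the generator $a(\bar e,i)$, which is represented by $\phi(\bar\Delta)^{-1}\Psi\phi(\bar\Delta)$.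
   Context: A directed $2$-complex $\mathcal{K}$ consists of: a directed graph (each edge $e$ has an initial vertex $\iota(e)$ and a terminal vertex $\tau(e)$); a set of $2$-cells; for each $2$-cell $f$, two nonempty directed paths $\lceil f\rceil$ (top) and $\lfloor f\rfloor$ (bottom) in the graph with the same initial vertex and the same terminal vertex; and a fixed-point-free involution $f\mapsto f^{-1}$ on $2$-cells with $\lceil f^{-1}\rceil=\lfloor f\rfloor$, $\lfloor f^{-1}\rfloor=\lceil f\rceil$. One $2$-cell in each pair $\{f,f^{-1}\}$ is called positive; a positive $2$-cell with top $u$ and bottom $v$ has the form $u=v$. Adding a $2$-cell always means adding its inverse as well. A $1$-path is a (possibly empty) directed path in the graph; $\iota,\tau$ extend to $1$-paths. The Squier complex $\mathrm{Sq}(\mathcal{K})$ is the $2$-dimensional cell complex whose vertices are the nonempty $1$-paths; whose edges are the triples $(u,f,v)$, with $u,v$ $1$-paths and $f$ a $2$-cell such that $u\lceil f\rceil v$ is a $1$-path, going from $u\lceil f\rceil v$ to $u\lfloor f\rfloor v$, with $(u,f,v)^{-1}=(u,f^{-1},v)$; and which has, for every $(u,f,q,g,r)$ with $f,g$ $2$-cells and $u\lceil f\rceil q\lceil g\rceil r$ a $1$-path, a $2$-cell attached along the loop $(u,f,q\lceil g\rceil r)\,(u\lfloor f\rfloor q,g,r)\,(u,f,q\lfloor g\rfloor r)^{-1}\,(u\lceil f\rceil q,g,r)^{-1}$. For a nonempty $1$-path $w$, $\mathcal{D}(\mathcal{K},w)=\pi_1(\mathrm{Sq}(\mathcal{K}),w)$.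 Two $1$-paths are homotopic if they are equal or joined by an edge path in $\mathrm{Sq}(\mathcal{K})$. Diagrams (considered up to equivalence, i.e. insertion/cancellation of dipoles): a diagram $\Delta$ over $\mathcal{K}$ with top $\lceil\Delta\rceil=u$ and bottom $\lfloor\Delta\rfloor=v$, also called a $(u,v)$-diagram, is a homotopy class (rel endpoints) of edge paths in $\mathrm{Sq}(\mathcal{K})$ from $u$ to $v$; products are concatenations and inverses are reversed paths. $\varepsilon(q)$ denotes the trivial diagram on $q$, and the atomic diagram $\varepsilon(q')+f+\varepsilon(q'')$ is the class of the edge $(q',f,q'')$. Elements of $\mathcal{D}(\mathcal{K},p)$ are the $(p,p)$-diagrams. Expansion: $\mathcal{K}_\nu$ is obtained from $\mathcal{K}$ by adding, for each edge $e$, $\nu(e)$ positive $2$-cells of the form $e=e$, called leaves attached to $e$. The retraction $\theta$ is induced by the map on edges of Squier complexes that sends $(u,f,v)$ to the trivial path at $u\lceil f\rceil v$ if $f^{\pm1}$ is a leaf, and to itself otherwise. Rooted $2$-tree with root $w$: a directed $2$-complex $\mathcal{M}$ such that (T1) for any vertex $o$ there is a $1$-path from $\iota(w)$ to $\tau(w)$ containing $o$; (T2) every two $1$-paths in $\mathcal{M}$ with the same endpoints are homotopic in $\mathcal{M}$; (T3) $\mathcal{D}(\mathcal{M},w)$ is trivial. Universal $2$-cover of $\mathcal{K}$ with base $p$: a directed $2$-complex $\widetilde{\mathcal{K}}_p$ with a labelling map $\phi\colon\widetilde{\mathcal{K}}_p\to\mathcal{K}$ (sending vertices to vertices, edges to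 edges, $2$-cells to $2$-cells, preserving $\iota$, $\tau$, tops, bottoms, inverses and positivity; it extends to $1$-paths and diagrams) such that (U1) $\widetilde{\mathcal{K}}_p$ is a rooted $2$-tree with a root $\tilde p$ satisfying $\phi(\tilde p)=p$; (U2) for any $1$-path $\tilde q$ from $\iota(\tilde p)$ to $\tau(\tilde p)$, the map induced by $\phi$ from the set of triples $(\tilde u,\tilde f,\tilde v)$ with $\tilde u\lceil\tilde f\rceil\tilde v=\tilde q$ to the set of triples $(u,f,v)$ over $\mathcal{K}$ with $u\lceil f\rceil v=\phi(\tilde q)$ is bijective. It exists and is unique up to label-preserving isomorphism. Consequently every diagram $\Xi$ over $\mathcal{K}$ with $\lfloor\Xi\rfloor=p$ has a lift: the unique diagram $\bar\Xi$ over $\widetilde{\mathcal{K}}_p$ with $\lfloor\bar\Xi\rfloor=\tilde p$ and $\phi(\bar\Xi)=\Xi$. Independence graph $\Gamma(\mathcal{M},w)$: its vertices are all edges of $\mathcal{M}$ that belong to $1$-paths homotopic to $w$; two distinct edges are adjacent iff they are independent, i.e. some $1$-path homotopic to $w$ contains both. For $\mathcal{M}=\widetilde{\mathcal{K}}_p$ independence is taken with respect to the root $\tilde p$. The graph product of groups $\{G_v\}_{v\in V}$ over a graph with vertex set $V$ is the quotient of the free product $\ast_{v\in V}G_v$ by the normal subgroup generated by all $[g,h]$ with $g\in G_s$, $h\in G_t$, $s,t$ adjacent. A presentation is partially commutative if all its defining relations are commutators of generators. *)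

(* Defs.v *)
From HB Require Import structures.
From mathcomp Require Import all_boot.
From mathcomp Require Import boolp classical_sets functions.
From Stdlib Require Import Relations.
From Stdlib Require List.

Set Implicit Arguments.
Unset Strict Implicit.
Unset Printing Implicit Defensive.

Local Open Scope group_scope.

(* A group up to an equivalence relation; [quot_group] is the genuine group
   ([groupType]) obtained by identifying equivalent elements. *)
Record sgroup := SGroup {
  sg_car :> Type;
  sg_eqv : sg_car -> sg_car -> Prop;
  sg_mul : sg_car -> sg_car -> sg_car;
  sg_one : sg_car;
  sg_inv : sg_car -> sg_car;
  sg_refl : forall x, sg_eqv x x;
  sg_sym : forall x y, sg_eqv x y -> sg_eqv y x;
  sg_trans : forall x y z, sg_eqv x y -> sg_eqv y z -> sg_eqv x z;
  sg_mul_eqv : forall x x' y y', sg_eqv x x' -> sg_eqv y y' ->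
    sg_eqv (sg_mul x y) (sg_mul x' y');
  sg_inv_eqv : forall x x', sg_eqv x x' -> sg_eqv (sg_inv x) (sg_inv x');
  sg_mulA : forall x y z,
    sg_eqv (sg_mul x (sg_mul y z)) (sg_mul (sg_mul x y) z);
  sg_mul1l : forall x, sg_eqv (sg_mul sg_one x) x;
  sg_mul1r : forall x, sg_eqv (sg_mul x sg_one) x;
  sg_mulVl : forall x, sg_eqv (sg_mul (sg_inv x) x) sg_one;
  sg_mulVr : forall x, sg_eqv (sg_mul x (sg_inv x)) sg_one
}.

Section QuotGroup.
Variable S : sgroup.

Definition sg_rel : rel {classic S} := fun x y => `[< sg_eqv x y >].

Lemma sg_rel_equiv : equiv_class_of sg_rel.
Proof.
split=> [x|x y|y x z]; rewrite /sg_rel.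
- by apply/asboolP/sg_refl.
- by apply/asboolP/asboolP; apply: sg_sym.
- by move=> /asboolP xy /asboolP yz; apply/asboolP/(sg_trans xy yz).
Qed.

Canonical sg_equiv := EquivRelPack sg_rel_equiv.

Definition quot_group : Type := {eq_quot sg_equiv}%qT.
HB.instance Definition _ := Choice.on quot_group.
HB.instance Definition _ := EqQuotient.on quot_group.

Definition qclass (x : S) : quot_group := (\pi_quot_group (x : {classic S}))%qT.
Definition qrepr (a : quot_group) : S := repr a.

Lemma qclassP (x y : S) : qclass x = qclass y <-> sg_eqv x y.
Proof.
split; last by move=> xy; apply/eqmodP/asboolP.
by move=> /eqmodP /asboolP.
Qed.

Lemma qreprK (a : quot_group) : qclass (qrepr a) = a.
Proof. by rewrite /qclass /qrepr reprK. Qed.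

Lemma qrepr_class (x : S) : sg_eqv (qrepr (qclass x)) x.
Proof. by apply/qclassP; rewrite qreprK. Qed.

Definition qmul (a b : quot_group) : quot_group :=
  qclass (sg_mul (qrepr a) (qrepr b)).
Definition qinv (a : quot_group) : quot_group := qclass (sg_inv (qrepr a)).
Definition qone : quot_group := qclass (sg_one S).

Lemma qmulE (x y : S) : qmul (qclass x) (qclass y) = qclass (sg_mul x y).
Proof. by apply/qclassP/sg_mul_eqv; apply: qrepr_class. Qed.

Lemma qinvE (x : S) : qinv (qclass x) = qclass (sg_inv x).
Proof. by apply/qclassP/sg_inv_eqv/qrepr_class. Qed.

Fact qmulA : associative qmul.
Proof.
move=> a b c; rewrite -[a]qreprK -[b]qreprK -[c]qreprK !qmulE.
exact/qclassP/sg_mulA.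
Qed.

Fact qmul1l : left_id qone qmul.
Proof. by move=> a; rewrite -[a]qreprK qmulE; apply/qclassP/sg_mul1l. Qed.

Fact qmul1r : right_id qone qmul.
Proof. by move=> a; rewrite -[a]qreprK qmulE; apply/qclassP/sg_mul1r. Qed.

Fact qmulVl : left_inverse qone qinv qmul.
Proof. by move=> a; rewrite -[a]qreprK qinvE qmulE; apply/qclassP/sg_mulVl. Qed.

Fact qmulVr : right_inverse qone qinv qmul.
Proof. by move=> a; rewrite -[a]qreprK qinvE qmulE; apply/qclassP/sg_mulVr. Qed.

HB.instance Definition _ :=
  isGroup.Build quot_group qmulA qmul1l qmul1r qmulVl qmulVr.

Lemma qclassM (x y : S) : qclass (sg_mul x y) = qclass x * qclass y.
Proof. by rewrite -qmulE. Qed.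

Lemma qclassV (x : S) : qclass (sg_inv x) = (qclass x)^-1.
Proof. by rewrite -qinvE. Qed.

End QuotGroup.

Inductive nclosure (G : groupType) (R : set G) : G -> Prop :=
| nclosure_in r : R r -> nclosure R r
| nclosure1 : nclosure R 1
| nclosureM x y : nclosure R x -> nclosure R y -> nclosure R (x * y)
| nclosureV x : nclosure R x -> nclosure R x^-1
| nclosureJ x g : nclosure R x -> nclosure R (x ^ g).

Section GroupQuotient.
Variables (G : groupType) (R : set G).

Definition nc_eqv (x y : G) : Prop := nclosure R (x^-1 * y).

Fact nc_refl x : nc_eqv x x.
Proof. by rewrite /nc_eqv mulVg; apply: nclosure1. Qed.

Fact nc_sym x y : nc_eqv x y -> nc_eqv y x.
Proof. by move=> /nclosureV; rewrite /nc_eqv invgM invgK. Qed.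

Fact nc_trans x y z : nc_eqv x y -> nc_eqv y z -> nc_eqv x z.
Proof. by move=> /nclosureM h /h; rewrite /nc_eqv mulgA mulgK. Qed.

Fact nc_mul x x' y y' : nc_eqv x x' -> nc_eqv y y' -> nc_eqv (x * y) (x' * y').
Proof.
move=> /(nclosureJ y) hx hy; rewrite /nc_eqv.
suff -> : (x * y)^-1 * (x' * y') = (x^-1 * x') ^ y * (y^-1 * y').
  exact: nclosureM.
by rewrite conjgE invgM !mulgA mulgK.
Qed.

Fact nc_inv x x' : nc_eqv x x' -> nc_eqv x^-1 x'^-1.
Proof.
move=> /nc_sym /(nclosureJ x^-1); rewrite /nc_eqv conjgE invgK !mulgA.
move=> h; suff -> : x * x'^-1 = x * x'^-1 * x * x^-1 by [].
by rewrite mulgK.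
Qed.

Definition quot_sgroup : sgroup.
Proof.
refine (@SGroup G nc_eqv (fun x y => x * y) 1 (fun x => x^-1) nc_refl nc_sym nc_trans nc_mul nc_inv
  _ _ _ _ _) => [x y z|x|x|x|x].
- by rewrite mulgA; apply: nc_refl.
- by rewrite mul1g; apply: nc_refl.
- by rewrite mulg1; apply: nc_refl.
- by rewrite mulVg; apply: nc_refl.
- by rewrite mulgV; apply: nc_refl.
Defined.

(* The quotient of [G] by the normal subgroup generated by [R]. *)
Definition nquot : groupType := quot_group quot_sgroup.
Definition nq_proj (x : G) : nquot := @qclass quot_sgroup x.

End GroupQuotient.

Section Words.
Variables (X : Type) (bar : X -> X) (R : seq X -> seq X -> Prop).

Definition word_step (s t : seq X) : Prop :=
  exists a l r b, [/\ R l r, s = a ++ l ++ b & t = a ++ r ++ b].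

(* The congruence on words generated by [R]. *)
Definition word_eqv : seq X -> seq X -> Prop :=
  clos_refl_sym_trans _ word_step.

Definition word_inv (s : seq X) : seq X := rev (map bar s).

Hypothesis barR : forall x, word_eqv [:: x; bar x] [::].
Hypothesis barL : forall x, word_eqv [:: bar x; x] [::].

Lemma word_ctx c d s t : word_eqv s t -> word_eqv (c ++ s ++ d) (c ++ t ++ d).
Proof.
elim=> [{}s {}t|{}s|{}s {}t _ IH|{}s {}t u _ IH1 _ IH2].
- move=> [a [l [r [b [lr -> ->]]]]]; apply: rst_step.
  by exists (c ++ a), l, r, (b ++ d); rewrite -!catA.
- exact: rst_refl.
- exact: rst_sym.
- exact: rst_trans IH1 IH2.
Qed.

Lemma word_cat s s' t t' :
  word_eqv s s' -> word_eqv t t' -> word_eqv (s ++ t) (s' ++ t').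
Proof.
move=> /(word_ctx [::] t) hs /(word_ctx s' [::]); rewrite !cats0.
exact: rst_trans hs.
Qed.

Lemma word_invR s : word_eqv (s ++ word_inv s) [::].
Proof.
elim: s => [|x s IH]; first exact: rst_refl.
rewrite /word_inv map_cons rev_cons -cats1 -/(word_inv s).
apply: rst_trans (barR x).
by have := word_ctx [:: x] [:: bar x] IH; rewrite /= -catA.
Qed.

Lemma word_invL s : word_eqv (word_inv s ++ s) [::].
Proof.
elim: s => [|x s IH]; first exact: rst_refl.
rewrite /word_inv map_cons rev_cons -cats1 -/(word_inv s).
apply: rst_trans IH.
by have := word_ctx (word_inv s) s (barL x); rewrite /= -catA.
Qed.

Lemma word_inv_eqv s t : word_eqv s t -> word_eqv (word_inv s) (word_inv t).
Proof.
move=> st.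
have h1 := word_cat (rst_refl _ _ (word_inv s)) (rst_sym _ _ _ _ (word_invR t)).
have h2 := word_cat (word_cat (rst_refl _ _ (word_inv s)) (rst_sym _ _ _ _ st))
  (rst_refl _ _ (word_inv t)).
have h3 := word_cat (word_invL s) (rst_refl _ _ (word_inv t)).
by rewrite cats0 catA in h1; apply: rst_trans h1 (rst_trans _ _ _ _ _ h2 h3).
Qed.

Definition word_sgroup : sgroup.
Proof.
refine (@SGroup (seq X) word_eqv cat [::] word_inv (@rst_refl _ _)
  (@rst_sym _ _) (@rst_trans _ _) word_cat word_inv_eqv _ _ _
  word_invL word_invR) => [s t u|s|s].
- by rewrite catA; apply: rst_refl.
- exact: rst_refl.
- by rewrite cats0; apply: rst_refl.
Defined.

End Words.

Section FreeGroup.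
Variable X : Type.

(* The letter [(x, true)] stands for [x], and [(x, false)] for its inverse. *)
Definition fg_bar (x : X * bool) : X * bool := (x.1, ~~ x.2).

Inductive fg_rel : seq (X * bool) -> seq (X * bool) -> Prop :=
| fg_cancel x : fg_rel [:: x; fg_bar x] [::].

Fact fg_barR x : word_eqv fg_rel [:: x; fg_bar x] [::].
Proof.
apply: rst_step; exists [::], [:: x; fg_bar x], [::], [::].
by split=> //; apply: fg_cancel.
Qed.

Fact fg_barL x : word_eqv fg_rel [:: fg_bar x; x] [::].
Proof.
have := fg_barR (fg_bar x); congr (word_eqv _ [:: _; _] _).
by case: x => x b; rewrite /fg_bar /= negbK.
Qed.

Definition free_group : groupType := quot_group (word_sgroup fg_barR fg_barL).
Definition fg_gen (x : X) : free_group :=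
  @qclass (word_sgroup fg_barR fg_barL) [:: (x, true)].

End FreeGroup.

Section FreeProduct.
Variables (V : Type) (G : V -> groupType).

Definition fp_bar (x : {v : V & G v}) : {v : V & G v} :=
  existT (fun v => G v : Type) (projT1 x) (projT2 x)^-1.

Inductive fp_rel : seq {v : V & G v} -> seq {v : V & G v} -> Prop :=
| fp_one v : fp_rel [:: existT (fun v => G v : Type) v 1] [::]
| fp_mul v (g h : G v) :
    fp_rel [:: existT (fun v => G v : Type) v g; existT (fun v => G v : Type) v h]
           [:: existT (fun v => G v : Type) v (g * h)].

Fact fp_cancel v (g h : G v) : g * h = 1 ->
  word_eqv fp_rel
    [:: existT (fun v => G v : Type) v g; existT (fun v => G v : Type) v h] [::].
Proof.
have step l r : fp_rel l r -> word_eqv fp_rel l r.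
  by move=> lr; apply: rst_step; exists [::], l, r, [::]; rewrite !cats0.
move=> gh; apply: rst_trans (step _ _ (fp_mul g h)) _.
by rewrite gh; apply/step/fp_one.
Qed.

Fact fp_barR x : word_eqv fp_rel [:: x; fp_bar x] [::].
Proof. by case: x => v g; apply/fp_cancel/mulgV. Qed.

Fact fp_barL x : word_eqv fp_rel [:: fp_bar x; x] [::].
Proof. by case: x => v g; apply/fp_cancel/mulVg. Qed.

Definition free_product : groupType :=
  quot_group (word_sgroup fp_barR fp_barL).
Definition fp_in (v : V) (g : G v) : free_product :=
  @qclass (word_sgroup fp_barR fp_barL) [:: existT (fun v => G v : Type) v g].

End FreeProduct.

Section GraphProduct.
Variables (V : Type) (adj : V -> V -> Prop) (G : V -> groupType).

Definition gp_commutators : set (free_product G) :=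
  [set c | exists s t (g : G s) (h : G t),
     adj s t /\ c = [~ fp_in g, fp_in h]].

Definition graph_product : groupType := nquot gp_commutators.
Definition gp_in (v : V) (g : G v) : graph_product :=
  nq_proj gp_commutators (fp_in g).

End GraphProduct.

Definition presented (X : Type) (R : set (free_group X)) : groupType := nquot R.
Definition pr_gen (X : Type) (R : set (free_group X)) (x : X) : presented R :=
  nq_proj R (fg_gen x).

Definition isom_onto (G H : groupType) (f : G -> H) (A : set H) : Prop :=
  injective f /\ range f = A.

Definition kernel (G H : groupType) (f : G -> H) : set G := [set x | f x = 1].

(* The vertices (edges) are the elements of [cV] satisfying [isV] (of [cE]
   satisfying [isE]).  [isF] is the set of the loops, written as sequences of
   oriented edges, along which the 2-cells are attached. *)
Record complex2 := Complex2 {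
  cV : Type;
  cE : Type;
  isV : cV -> Prop;
  isE : cE -> Prop;
  csrc : cE -> cV;
  ctgt : cE -> cV;
  cinv : cE -> cE;
  isF : seq cE -> Prop;
  csrcV : forall e, isE e -> isV (csrc e);
  cinvE : forall e, isE e -> isE (cinv e);
  cinvK : involutive cinv;
  csrc_inv : forall e, csrc (cinv e) = ctgt e
}.

Section Homotopy.
Variable X : complex2.
Implicit Types (x y z : cV X) (s t : seq (cE X)).

Fixpoint epath x s y : Prop :=
  if s is e :: s' then [/\ isE e, csrc e = x & epath (ctgt e) s' y]
  else isV x /\ x = y.

Inductive null_loop : seq (cE X) -> Prop :=
| null_backtrack e : null_loop [:: e; cinv e]
| null_face s : isF s -> null_loop s.

Definition homot_step x y s t : Prop := exists a r b,
  [/\ null_loop r, s = a ++ b, t = a ++ r ++ b, epath x s y & epath x t y].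

Definition homot x y : seq (cE X) -> seq (cE X) -> Prop :=
  clos_refl_sym_trans _ (homot_step x y).

Definition einv s : seq (cE X) := rev (map (@cinv X) s).

Lemma epath_isVl x s y : epath x s y -> isV x.
Proof. by case: s => [|e s] [] // hE <- _; apply: csrcV. Qed.

Lemma epath_cat x s t y :
  epath x (s ++ t) y <-> exists z, epath x s z /\ epath z t y.
Proof.
elim: s x => [|e s IH] x /=.
  split=> [h|[z [[_ ->]]]] //; exists x; split=> //.
  by split=> //; apply: epath_isVl h.
split=> [[hE hs /IH[z [h1 h2]]]|[z [[hE hs h1] h2]]]; first by exists z.
by split=> //; apply/IH; exists z.
Qed.

Lemma epath_catI x s z t y : epath x s z -> epath z t y -> epath x (s ++ t) y.
Proof. by move=> h1 h2; apply/epath_cat; exists z. Qed.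

Lemma ctgt_inv (e : cE X) : ctgt (cinv e) = csrc e.
Proof. by rewrite -csrc_inv cinvK. Qed.

Lemma ctgtV (e : cE X) : isE e -> isV (ctgt e).
Proof. by move=> /cinvE /csrcV; rewrite csrc_inv. Qed.

Lemma einv_cons e s : einv (e :: s) = einv s ++ [:: cinv e].
Proof. by rewrite /einv map_cons rev_cons cats1. Qed.

Lemma einv_cat s t : einv (s ++ t) = einv t ++ einv s.
Proof. by rewrite /einv map_cat rev_cat. Qed.

Lemma einvK : involutive einv.
Proof.
move=> s; rewrite /einv map_rev revK; elim: s => //= e s ->.
by rewrite cinvK.
Qed.

Lemma epath_inv x s y : epath x s y -> epath y (einv s) x.
Proof.
elim: s x => [|e s IH] x; first by case=> h <-.
move=> [hE hs h]; rewrite einv_cons; apply: epath_catI (IH _ h) _.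
split; [exact: cinvE | exact: csrc_inv | rewrite ctgt_inv; split=> //].
exact: csrcV.
Qed.

Lemma homot_epath x y s t : homot x y s t -> epath x s y <-> epath x t y.
Proof.
elim=> [{}s {}t|{}s|{}s {}t _ IH|{}s {}t u _ IH1 _ IH2].
- by move=> [a [r [b []]]].
- by [].
- by rewrite IH.
- by rewrite IH1.
Qed.

Lemma homot_ctx x y z w c d s t : epath x c y -> epath z d w ->
  homot y z s t -> homot x w (c ++ s ++ d) (c ++ t ++ d).
Proof.
move=> hc hd; elim=> [{}s {}t|{}s|{}s {}t _ IH|{}s {}t u _ IH1 _ IH2].
- move=> [a [r [b [hr -> -> h1 h2]]]]; apply: rst_step.
  exists (c ++ a), r, (b ++ d); split=> //; rewrite -?catA //.
  + by apply: epath_catI hc _; rewrite catA; apply: epath_catI hd.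
  + apply: epath_catI hc _.
    by move: (epath_catI h2 hd); rewrite -!catA.
- exact: rst_refl.
- exact: rst_sym.
- exact: rst_trans IH1 IH2.
Qed.

Lemma homot_cat x y z s s' t t' : epath x s' y -> epath y t z ->
  homot x y s s' -> homot y z t t' -> homot x z (s ++ t) (s' ++ t').
Proof.
move=> hs' ht h1 h2.
have hx : epath x [::] x by split; first exact: epath_isVl hs'.
have hz : epath z [::] z.
  by split=> //; apply: epath_isVl (epath_inv ht).
have := homot_ctx hx ht h1; have := homot_ctx hs' hz h2.
by rewrite !cats0 /= => k2 k1; apply: rst_trans k1 k2.
Qed.

Lemma homot_invR x s y : epath x s y -> homot x x (s ++ einv s) [::].
Proof.
elim: s x => [|e s IH] x; first by move=> _; apply: rst_refl.
move=> [hE hs h]; rewrite einv_cons.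
have hx : isV x by rewrite -hs; apply: csrcV.
have he : epath x [:: e] (ctgt e) by split=> //; split=> //; apply: ctgtV.
have he' : epath (ctgt e) [:: cinv e] x.
  by rewrite -hs; apply: (epath_inv (s := [:: e])); rewrite hs.
have := homot_ctx he he' (IH _ h); rewrite /= -catA => k.
apply: rst_trans k _; apply: rst_sym; apply: rst_step.
exists [::], [:: e; cinv e], [::]; split=> //; first exact: null_backtrack.
Qed.

Lemma homot_invL x s y : epath x s y -> homot y y (einv s ++ s) [::].
Proof. by move=> /epath_inv /homot_invR; rewrite einvK. Qed.

Lemma homot_inv x y s t : epath x s y -> homot x y s t ->
  homot y x (einv s) (einv t).
Proof.
move=> hs st; have ht := (homot_epath st).1 hs.
have hsi := epath_inv hs; have hti := epath_inv ht.
have hx : epath x [::] x by split; first exact: epath_isVl hs.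
have hy : epath y [::] y by split; first exact: epath_isVl hsi.
have h1 := homot_ctx hsi hx (homot_invR ht).
have h2 := homot_ctx hsi hti st.
have h3 := homot_ctx hy hti (homot_invL hs).
rewrite !cats0 /= in h1; rewrite /= -catA in h3.
by apply: rst_trans (rst_sym _ _ _ _ h1) (rst_trans _ _ _ _ _ (rst_sym _ _ _ _ h2) h3).
Qed.

Lemma epath_tgt_uniq x s y y' : epath x s y -> epath x s y' -> y = y'.
Proof.
elim: s x => [|e s IH] x /=; first by move=> [_ <-] [].
by move=> [_ _ /IH h] [_ _ /h].
Qed.

Lemma epath_src_uniq x x' s y : epath x s y -> epath x' s y -> x = x'.
Proof. by move=> /epath_inv h /epath_inv /(epath_tgt_uniq h). Qed.

Variables (x : cV X) (hx : isV x).

Definition loop : Type := {s : seq (cE X) | epath x s x}.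

Definition loop_mul (s t : loop) : loop :=
  exist _ (sval s ++ sval t) (epath_catI (svalP s) (svalP t)).
Definition loop_one : loop :=
  exist (fun s => epath x s x) [::] (conj hx erefl).
Definition loop_inv (s : loop) : loop :=
  exist _ (einv (sval s)) (epath_inv (svalP s)).

Definition loop_sgroup : sgroup.
Proof.
refine (@SGroup loop (fun s t : loop => homot x x (sval s) (sval t))
  loop_mul loop_one loop_inv _ _ _ _ _ _ _ _ _ _) => /=.
- by move=> s; apply: rst_refl.
- by move=> s t; apply: rst_sym.
- by move=> s t u; apply: rst_trans.
- move=> [s hs] [s' hs'] [t ht] [t' ht'] /=; exact: homot_cat.
- by move=> [s hs] [t ht] /=; apply: homot_inv.
- by move=> s t u; rewrite catA; apply: rst_refl.
- by move=> s; apply: rst_refl.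
- by move=> s; rewrite cats0; apply: rst_refl.
- by move=> [s hs]; apply: homot_invL hs.
- by move=> [s hs]; apply: homot_invR hs.
Defined.

Definition pi1 : groupType := quot_group loop_sgroup.
Definition pi1_class (s : loop) : pi1 := @qclass loop_sgroup s.

Definition represents (s : seq (cE X)) (g : pi1) : Prop :=
  exists h : epath x s x, g = pi1_class (exist _ s h).

End Homotopy.

(* A cellular map: an edge goes to an edge path, and a loop bounding a 2-cell
   goes to a null-homotopic loop. *)
Record cmap (X Y : complex2) := CMap {
  mapV :> cV X -> cV Y;
  mapE : cE X -> seq (cE Y);
  mapV_isV : forall x, isV x -> isV (mapV x);
  mapE_path : forall e, isE e -> epath (mapV (csrc e)) (mapE e) (mapV (ctgt e));
  mapE_inv : forall e, mapE (cinv e) = einv (mapE e);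
  mapE_face : forall x s, isF s -> epath x s x ->
    homot (mapV x) (mapV x) (flatten (map mapE s)) [::]
}.

Definition map_epath (X Y : complex2) (F : cmap X Y) (s : seq (cE X)) :
  seq (cE Y) := flatten (map (mapE F) s).

Section Pi1Map.
Variables (X Y : complex2) (F : cmap X Y).

Lemma map_epath_cat s t :
  map_epath F (s ++ t) = map_epath F s ++ map_epath F t.
Proof. by rewrite /map_epath map_cat flatten_cat. Qed.

Lemma map_epathP x s y : epath x s y -> epath (F x) (map_epath F s) (F y).
Proof.
elim: s x => [|e s IH] x /=; first by case=> h <-; split=> //; apply: mapV_isV.
by case=> hE <- /IH h; apply: epath_catI (mapE_path F hE) h.
Qed.

Lemma map_homot x y s t : homot x y s t ->
  homot (F x) (F y) (map_epath F s) (map_epath F t).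
Proof.
elim=> [{}s {}t|{}s|{}s {}t _ IH|{}s {}t u _ IH1 _ IH2].
- move=> [a [r [b [hr -> -> h1 h2]]]].
  move: h2 => /epath_cat [z [ha /epath_cat [w [hrr hb]]]].
  move: h1 => /epath_cat [z' [ha' hb']].
  have ez := epath_tgt_uniq ha' ha; rewrite ez {ha' ez} in hb'.
  have zw := epath_src_uniq hb hb'; rewrite zw {hb' zw} in hrr hb.
  apply: rst_sym; rewrite !map_epath_cat.
  apply: (homot_ctx (t := [::]) (map_epathP ha) (map_epathP hb)).
  case: hr hrr => [e|r0 hF] hrr; last exact: mapE_face hF hrr.
  rewrite /map_epath /= cats0 mapE_inv.
  by case: hrr => hE <- _; apply: homot_invR (mapE_path F hE).
- exact: rst_refl.
- exact: rst_sym.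
- exact: rst_trans IH1 IH2.
Qed.

Variables (x : cV X) (hx : isV x) (y : cV Y) (hy : isV y) (Fxy : F x = y).

Definition map_loop (s : loop x) : loop y :=
  exist _ (map_epath F (sval s))
    (ecast z (epath z (map_epath F (sval s)) z) Fxy (map_epathP (svalP s))).

Definition pi1_map (g : pi1 hx) : pi1 hy := pi1_class hy (map_loop (qrepr g)).

Lemma pi1_map_class (s : loop x) :
  pi1_map (pi1_class hx s) = pi1_class hy (map_loop s).
Proof.
apply/qclassP; rewrite /= -Fxy; apply: map_homot.
exact: (@qrepr_class (loop_sgroup hx) s).
Qed.

Fact pi1_map_is_morphism : {morph pi1_map : g h / g * h}.
Proof.
move=> g h; rewrite -[g]qreprK -[h]qreprK -qclassM !pi1_map_class.
rewrite -[RHS]qclassM; apply/qclassP => /=.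
by rewrite map_epath_cat; apply: rst_refl.
Qed.

HB.instance Definition _ :=
  isMultiplicative.Build (pi1 hx) (pi1 hy) pi1_map pi1_map_is_morphism.

End Pi1Map.

Record dgraph := DGraph {
  vertex : Type;
  edge : Type;
  ini : edge -> vertex;
  ter : edge -> vertex
}.

(* The 1-path with edges [s] goes from [x] to [y]. *)
Fixpoint walk (G : dgraph) (x : vertex G) (s : seq (edge G)) (y : vertex G) :
  Prop :=
  if s is e :: s' then ini e = x /\ walk (ter e) s' y else x = y.

(* A nonempty 1-path is determined by its sequence of edges. *)
Definition path1 (G : dgraph) (s : seq (edge G)) : Prop :=
  s <> [::] /\ exists x y, walk x s y.

Record dcomplex := DComplex {
  graph_of :> dgraph;
  cell : Type;
  top : cell -> seq (edge graph_of);
  bot : cell -> seq (edge graph_of);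
  cell_inv : cell -> cell;
  positive : pred cell;
  top_neq0 : forall f, top f <> [::];
  top_bot_walk : forall f, exists x y, walk x (top f) y /\ walk x (bot f) y;
  cell_invK : involutive cell_inv;
  cell_inv_neq : forall f, cell_inv f <> f;
  top_inv : forall f, top (cell_inv f) = bot f;
  bot_inv : forall f, bot (cell_inv f) = top f;
  positive_inv : forall f, positive (cell_inv f) = ~~ positive f
}.

Lemma bot_neq0 (K : dcomplex) (f : cell K) : bot f <> [::].
Proof. by rewrite -top_inv; apply: top_neq0. Qed.

Section Walks.
Variable G : dgraph.
Implicit Types (x y z : vertex G) (s t : seq (edge G)).

Lemma walk_cat x s t y :
  walk x (s ++ t) y <-> exists z, walk x s z /\ walk z t y.
Proof.
elim: s x => [|e s IH] x /=.
  by split=> [h|[z [-> h]]] //; exists x.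
split=> [[he /IH [z [h1 h2]]]|[z [[he h1] h2]]]; first by exists z.
by split=> //; apply/IH; exists z.
Qed.

Lemma walk_uniq x y x' y' s : s <> [::] ->
  walk x s y -> walk x' s y' -> x = x' /\ y = y'.
Proof.
case: s => // e s _ [<- h] [<- h']; split=> //.
by elim: s (ter e) h h' => [|e' s IH] z /=; [move=> <- | move=> [_ h] [_]; apply: IH].
Qed.

End Walks.

Section Squier.
Variable K : dcomplex.

Record triple := Triple {
  tl : seq (edge K);
  tc : cell K;
  tr : seq (edge K)
}.

Definition triple_top (t : triple) := tl t ++ top (tc t) ++ tr t.
Definition triple_bot (t : triple) := tl t ++ bot (tc t) ++ tr t.
Definition triple_inv (t : triple) := Triple (tl t) (cell_inv (tc t)) (tr t).

Inductive sq_face : seq triple -> Prop :=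
| Sq_face u f q g r : path1 (u ++ top f ++ q ++ top g ++ r) ->
    sq_face [:: Triple u f (q ++ top g ++ r);
                Triple (u ++ bot f ++ q) g r;
                triple_inv (Triple u f (q ++ bot g ++ r));
                triple_inv (Triple (u ++ top f ++ q) g r)].

Lemma path1_bot u f v : path1 (u ++ top f ++ v) -> @path1 K (u ++ bot f ++ v).
Proof.
move=> [_ [x [y /walk_cat [z [hu /walk_cat [w [hf hv]]]]]]]; split.
  by case: u {hu} => //; case: (bot f) (@bot_neq0 _ f).
exists x, y; apply/walk_cat; exists z; split=> //.
apply/walk_cat; exists w; split=> //.
have [x' [y' [ht hb]]] := top_bot_walk f.
by have [-> ->] := walk_uniq (@top_neq0 _ f) hf ht.
Qed.

Definition Sq : complex2.
Proof.
refine (@Complex2 (seq (edge K)) triple (@path1 K)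
  (fun t => path1 (triple_top t)) triple_top triple_bot triple_inv sq_face
  _ _ _ _).
- by [].
- by move=> [u f v]; rewrite /triple_top /= top_inv; apply: path1_bot.
- by move=> [u f v]; rewrite /triple_inv /= cell_invK.
- by move=> [u f v]; rewrite /triple_top /triple_bot /= top_inv.
Defined.

Definition diagram_group (w : seq (edge K)) (hw : path1 w) : groupType := @pi1 Sq w hw.

(* An empty 1-path is represented by [::], whatever its base vertex; it is no
   vertex of the Squier complex. *)
Definition homotopic (s t : seq (edge K)) : Prop :=
  s = t \/ exists d, @epath Sq s d t.

(* Edges are independent only if they are distinct. *)
Definition independent (w : seq (edge K)) (e1 e2 : edge K) : Prop :=
  e1 <> e2 /\ exists s, [/\ homotopic s w, List.In e1 s & List.In e2 s].

Definition ind_vertex (w : seq (edge K)) : Type :=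
  {e : edge K | exists s, homotopic s w /\ List.In e s}.

Definition ind_adj (w : seq (edge K)) (e1 e2 : ind_vertex w) : Prop :=
  independent w (sval e1) (sval e2).

Definition rooted_2tree (w : seq (edge K)) : Prop :=
  exists hw : path1 w,
  [/\ forall o x y, walk x w y -> exists s t, walk x s o /\ walk o t y,
      forall x y s t, walk x s y -> walk x t y -> homotopic s t &
      forall g : diagram_group hw, g = 1].

End Squier.

Record dmap (K L : dcomplex) := DMap {
  mapv : vertex K -> vertex L;
  mape :> edge K -> edge L;
  mapc : cell K -> cell L;
  mape_ini : forall e, ini (mape e) = mapv (ini e);
  mape_ter : forall e, ter (mape e) = mapv (ter e);
  mapc_top : forall f, top (mapc f) = map mape (top f);
  mapc_bot : forall f, bot (mapc f) = map mape (bot f);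
  mapc_inv : forall f, mapc (cell_inv f) = cell_inv (mapc f);
  mapc_positive : forall f, positive (mapc f) = positive f
}.

Section SqMap.
Variables (K L : dcomplex) (phi : dmap K L).

Definition map_triple (t : triple K) : triple L :=
  Triple (map phi (tl t)) (mapc phi (tc t)) (map phi (tr t)).

Lemma map_walk x s y : walk x s y -> walk (mapv phi x) (map phi s) (mapv phi y).
Proof.
elim: s x => [|e s IH] x /=; first by move=> ->.
by move=> [<- /IH]; rewrite mape_ini mape_ter.
Qed.

Lemma map_path1 s : path1 s -> path1 (map phi s).
Proof.
move=> [h [x [y /map_walk hw]]]; split; last by eexists _, _; apply: hw.
by case: s h {hw}.
Qed.

Lemma map_triple_top t : triple_top (map_triple t) = map phi (triple_top t).
Proof. by rewrite /triple_top /= mapc_top !map_cat. Qed.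

Lemma map_triple_bot t : triple_bot (map_triple t) = map phi (triple_bot t).
Proof. by rewrite /triple_bot /= mapc_bot !map_cat. Qed.

Fact Sq_map_path (e : triple K) : path1 (triple_top e) ->
  @epath (Sq L) (map phi (triple_top e)) [:: map_triple e] (map phi (triple_bot e)).
Proof.
move=> h /=; rewrite map_triple_top map_triple_bot; split=> //.
  exact: map_path1.
split=> //; apply: map_path1.
by move: h; apply: path1_bot.
Qed.

Fact Sq_map_inv (e : triple K) :
  [:: map_triple (triple_inv e)] = @einv (Sq L) [:: map_triple e].
Proof. by rewrite /einv /= /triple_inv /map_triple /= mapc_inv. Qed.

Fact Sq_map_face x s : sq_face s -> @epath (Sq K) x s x ->
  @homot (Sq L) (map phi x) (map phi x)
    (flatten (map (fun e => [:: map_triple e]) s)) [::].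
Proof.
move=> hs hx.
have hm : @epath (Sq L) (map phi x)
    (flatten (map (fun e => [:: map_triple e]) s)) (map phi x).
  elim: s {1 3}x hx {hs} => [|e s IH] z /=.
    by move=> [hz <-]; split=> //; apply: map_path1.
  move=> [he <- /IH h]; split.
  - by rewrite map_triple_top; apply: map_path1.
  - exact: map_triple_top.
  - by rewrite /= map_triple_bot.
have hV : @isV (Sq L) (map phi x) := epath_isVl hm.
apply: rst_sym; apply: rst_step; exists [::], (flatten (map (fun e => [:: map_triple e]) s)), [::].
rewrite !cats0; split=> //; apply: null_face.
case: hs {hx hm} => u f q g r h.
rewrite /= /map_triple /= !mapc_inv !map_cat -!mapc_top -!mapc_bot.
apply: Sq_face; rewrite !mapc_top -!map_cat.
exact: map_path1.
Qed.

Definition Sq_map : cmap (Sq K) (Sq L) :=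
  @CMap (Sq K) (Sq L) (map phi) (fun e => [:: map_triple e])
    map_path1 Sq_map_path Sq_map_inv Sq_map_face.

End SqMap.

(* [xib] is an edge path representing the lift, with top [qt], of the diagram
   represented by the edge path [xi] from [q] to [p]. *)
Definition is_lift (K Kt : dcomplex) (phi : dmap Kt K) (pt : seq (edge Kt))
    (p q : seq (edge K)) (xi : seq (triple K))
    (qt : seq (edge Kt)) (xib : seq (triple Kt)) : Prop :=
  [/\ @epath (Sq Kt) qt xib pt, map phi qt = q &
      @homot (Sq K) q p (map_epath (Sq_map phi) xib) xi].

(* The Squier edges (u, f, v) starting at the 1-path q. *)
Definition applicable (K : dcomplex) (q : seq (edge K)) : set (triple K) :=
  [set t | triple_top t = q].

Definition universal_cover (K Kt : dcomplex) (phi : dmap Kt K)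
    (pt : seq (edge Kt)) (p : seq (edge K)) : Prop :=
  [/\ rooted_2tree pt,
      map phi pt = p &
      forall x y qt, walk x pt y -> walk x qt y ->
        set_bij (applicable qt) (applicable (map phi qt)) (map_triple phi)].

Section Expansion.
(* The cardinal nu(e) is that of the index type [I e]. *)
Variables (K : dcomplex) (I : edge K -> Type).

(* [inr (existT _ e i, true)] is the i-th leaf attached to e, and
   [inr (existT _ e i, false)] is its inverse. *)
Definition exp_cell : Type := (cell K + {e : edge K & I e} * bool)%type.

Definition exp_top (f : exp_cell) : seq (edge K) :=
  match f with inl f => top f | inr l => [:: projT1 l.1] end.
Definition exp_bot (f : exp_cell) : seq (edge K) :=
  match f with inl f => bot f | inr l => [:: projT1 l.1] end.
Definition exp_inv (f : exp_cell) : exp_cell :=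
  match f with inl f => inl (cell_inv f) | inr l => inr (l.1, ~~ l.2) end.
Definition exp_positive (f : exp_cell) : bool :=
  match f with inl f => positive f | inr l => l.2 end.

Definition expansion : dcomplex.
Proof.
refine (@DComplex K exp_cell exp_top exp_bot exp_inv exp_positive
  _ _ _ _ _ _ _).
- by case=> [f|[[e i] b]] //; apply: top_neq0.
- case=> [f|[[e i] b]]; first exact: top_bot_walk.
  by exists (ini e), (ter e).
- by case=> [f|[l b]] /=; rewrite ?cell_invK ?negbK.
- by case=> [f [/cell_inv_neq]|[l [] []]].
- by case=> [f|[l b]] //=; apply: top_inv.
- by case=> [f|[l b]] //=; apply: bot_inv.
- by case=> [f|[l b]] //=; apply: positive_inv.
Defined.

Definition leaf (e : edge K) (i : I e) : cell expansion :=
  inr (existT I e i, true).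

Definition exp_incl : dmap K expansion.
Proof.
by refine (@DMap K expansion id id inl _ _ _ _ _ _) => //= f; rewrite map_id.
Defined.

Definition retr_edge (t : triple expansion) : seq (triple K) :=
  match tc t with
  | inl f => [:: Triple (tl t : seq (edge K)) f (tr t)]
  | inr _ => [::]
  end.

Fact retr_path (e : triple expansion) : path1 (triple_top e) ->
  @epath (Sq K) (triple_top e) (retr_edge e) (triple_bot e).
Proof.
case: e => u [f|[l b]] v h /=; last by [].
by split=> //; split=> //; apply: path1_bot.
Qed.

Fact retr_inv (e : triple expansion) :
  retr_edge (triple_inv e) = @einv (Sq K) (retr_edge e).
Proof. by case: e => u [f|[l b]] v. Qed.

Fact retr_face x s : @sq_face expansion s -> @epath (Sq expansion) x s x ->
  @homot (Sq K) x x (flatten (map retr_edge s)) [::].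
Proof.
move=> hs hx.
have hm : @epath (Sq K) x (flatten (map retr_edge s)) x.
  elim: s {1 3}x hx {hs} => [|e s IH] z //= [he <- /IH h].
  exact: epath_catI (retr_path he) h.
have hV : @isV (Sq K) x := epath_isVl hm.
have null r : @null_loop (Sq K) r -> @epath (Sq K) x r x ->
    @homot (Sq K) x x r [::].
  move=> hr hxr; apply: rst_sym; apply: rst_step.
  by exists [::], r, [::]; split=> //=; rewrite cats0.
case: hs hm {hx} => u [f|l] q [g|l'] r h hm; last exact: rst_refl.
- apply: (null _ _ hm); apply: null_face.
  exact: (@Sq_face K u f q g r h).
- apply: (null _ _ hm).
  exact: (@null_backtrack (Sq K) (Triple (u : seq (edge K)) f (q ++ projT1 l'.1 :: r))).
- apply: (null _ _ hm).
  exact: (@null_backtrack (Sq K) (Triple (u ++ projT1 l.1 :: q : seq (edge K)) g r)).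
Qed.

Definition retraction : cmap (Sq expansion) (Sq K) :=
  @CMap (Sq expansion) (Sq K) id retr_edge (fun _ h => h)
    retr_path retr_inv retr_face.

(* The edge path (delta^-1) (q', f_i, q'') delta, where f_i is the i-th leaf
   attached to e. *)
Definition leaf_conj (q' : seq (edge K)) (e : edge K) (i : I e)
    (q'' : seq (edge K)) (delta : seq (triple K)) : seq (triple expansion) :=
  let delta' := map_epath (Sq_map exp_incl) delta in
  @einv (Sq expansion) delta'
    ++ [:: @Triple expansion q' (leaf i) q''] ++ delta'.

Variables (p : seq (edge K)) (hp : path1 p).

Definition Dexp : groupType := @diagram_group expansion p hp.

Definition theta : {multiplicative Dexp -> diagram_group hp} :=
  @pi1_map (Sq expansion) (Sq K) retraction p hp p hp erefl.

(* Diagrams over K viewed as diagrams over the expansion. *)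
Definition incl_exp : {multiplicative diagram_group hp -> Dexp} :=
  @pi1_map (Sq K) (Sq expansion) (Sq_map exp_incl) p hp p hp (map_id p).

End Expansion.

(* Main.v *)
From HB Require Import structures.
Require Import Defs.
From mathcomp Require Import all_boot.
From mathcomp Require Import boolp classical_sets functions.
From Stdlib Require Import Relations.
From Stdlib Require List.

(* The map of Squier complexes Sq(Kt_nu) -> Sq(K_nu) induced by the labelling
   [phi], where nu is pulled back along [phi], lifts paths and homotopies
   uniquely from the 1-paths parallel to the root, because both a cell and a
   leaf can be lifted uniquely there.  A loop at [p] over [K_nu] therefore lifts
   to a loop at [pt] exactly when its retraction does in Sq(Kt), that is (Kt
   being simply connected) when it lies in the kernel of theta; so the kernel is
   the diagram group D(Kt_nu, pt).

   It remains to compute D(Kt_nu, pt) for the rooted 2-tree Kt.  Faces of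
   Sq(Kt_nu) between a leaf and a cell of Kt let the leaf loop at [s ++ e :: v]
   slide along any change of [s] and of [v], so its conjugate to the base depends
   on [e] and the leaf only; faces between two leaves give the commutation
   relations.  Conversely, reading off the leaves met by an edge path defines a
   homomorphism to any group containing suitably commuting elements, since a
   rooted 2-tree has no directed cycle and hence two leaves of one face sit on
   distinct, independent edges.  This is the universal property of the partially
   commutative group, and also of the graph product of free groups. *)

Set Implicit Arguments.
Unset Strict Implicit.
Unset Printing Implicit Defensive.

Local Open Scope group_scope.

(** * Universal properties *)

Section Morphisms.
Variables (G H : groupType).
Implicit Type f : {multiplicative G -> H}.

Lemma mult1 f : f 1 = 1.
Proof. by apply: (mulgI (f 1)); rewrite -gmulfM !mulg1. Qed.

Lemma multV f x : f x^-1 = (f x)^-1.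
Proof. by apply: (mulgI (f x)); rewrite -gmulfM !mulgV mult1. Qed.

Lemma multR f x y : f [~ x, y] = [~ f x, f y].
Proof. by rewrite !gmulfM !multV. Qed.

Lemma mult_inj f : (forall x, f x = 1 -> x = 1) -> injective f.
Proof.
move=> fI x y xy; apply/divg1_eq/fI.
by rewrite gmulfM multV xy mulgV.
Qed.

End Morphisms.

Lemma qclass1 (S : sgroup) : qclass (sg_one S) = 1.
Proof. by []. Qed.

Lemma quot_lift (S : sgroup) (H : groupType) (F : S -> H) :
    (forall x y, sg_eqv x y -> F x = F y) ->
    (forall x y, F (sg_mul x y) = F x * F y) ->
  exists f : {multiplicative quot_group S -> H}, forall x, f (qclass x) = F x.
Proof.
move=> Feqv FM; pose f (a : quot_group S) := F (qrepr a).
have fE x : f (qclass x) = F x by apply/Feqv/qrepr_class.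
have fM : {morph f : a b / a * b}.
  by move=> a b; rewrite -[a]qreprK -[b]qreprK -qclassM !fE FM.
pose fM' := isMultiplicative.Build _ _ f fM.
pose f' : {multiplicative quot_group S -> H} := HB.pack f fM'.
by exists f'.
Qed.

Lemma nquot_lift (G H : groupType) (R : set G) (F : {multiplicative G -> H}) :
    (forall r, R r -> F r = 1) ->
  exists f : {multiplicative nquot R -> H}, forall x, f (nq_proj R x) = F x.
Proof.
move=> FR; apply: (@quot_lift (quot_sgroup R) H F); last exact: gmulfM.
move=> x y /= xy; have {xy}: F (x^-1 * y) = 1.
  elim: xy => [r /FR|| {}x {}y _ Fx _ Fy|{}x _ Fx|{}x g _ Fx] //.
  - exact: mult1.
  - by rewrite gmulfM Fx Fy mulg1.
  - by rewrite multV Fx invg1.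
  - by rewrite conjgE !gmulfM Fx mul1g -gmulfM mulVg mult1.
by rewrite gmulfM multV => xy; apply: (mulgI (F x)^-1); rewrite mulVg xy.
Qed.

Lemma nq_projM (G : groupType) (R : set G) : {morph nq_proj R : x y / x * y}.
Proof. by move=> x y; rewrite -[RHS]qclassM. Qed.

HB.instance Definition _ (G : groupType) (R : set G) :=
  isMultiplicative.Build G (nquot R) (nq_proj R) (@nq_projM G R).

Lemma nq_proj_rel (G : groupType) (R : set G) r : R r -> nq_proj R r = 1.
Proof.
move=> Rr; apply/esym/qclassP => /=.
by rewrite /nc_eqv invg1 mul1g; apply: nclosure_in.
Qed.

Section WordGroup.
Variables (X : Type) (bar : X -> X) (R : seq X -> seq X -> Prop).
Hypothesis barR : forall x, word_eqv R [:: x; bar x] [::].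
Hypothesis barL : forall x, word_eqv R [:: bar x; x] [::].
Let W := word_sgroup barR barL.

Definition word_prod (H : groupType) (c : X -> H) (s : seq X) : H :=
  foldr (fun x h => c x * h) 1 s.

Lemma word_prod_cat (H : groupType) (c : X -> H) s t :
  word_prod c (s ++ t) = word_prod c s * word_prod c t.
Proof. by elim: s => [|x s /= ->]; rewrite ?mul1g ?mulgA. Qed.

Lemma word_lift (H : groupType) (c : X -> H) :
    (forall s t, R s t -> word_prod c s = word_prod c t) ->
  exists f : {multiplicative quot_group W -> H},
    forall x, f (@qclass W [:: x]) = c x.
Proof.
move=> cR.
have [] := @quot_lift W H (word_prod c).
- move=> s t; elim=> [{}s {}t|//|{}s {}t _ ->//|{}s {}t u _ -> _ ->//].
  move=> [a [l [r [b [/cR lr -> ->]]]]].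
  by rewrite !word_prod_cat lr.
- exact: word_prod_cat.
- by move=> f fE; exists f => x; rewrite fE /= mulg1.
Qed.

Lemma word_lift_uniq (H : groupType) (f g : {multiplicative quot_group W -> H}) :
  (forall x, f (@qclass W [:: x]) = g (@qclass W [:: x])) -> f =1 g.
Proof.
move=> fg a; rewrite -[a]qreprK; elim: (qrepr a) => [|x s IH].
  by rewrite (@qclass1 W) !mult1.
by rewrite (@qclassM W [:: x] s) !gmulfM fg IH.
Qed.

End WordGroup.

Section FreeGroupLift.
Variables (X : Type) (H : groupType).

Lemma fg_genV (x : X) :
  (fg_gen x)^-1 = @qclass (word_sgroup (@fg_barR X) (@fg_barL X)) [:: (x, false)].
Proof. by rewrite -qclassV. Qed.

Lemma free_group_lift (c : X -> H) :
  exists f : {multiplicative free_group X -> H}, forall x, f (fg_gen x) = c x.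
Proof.
pose c' (x : X * bool) := if x.2 then c x.1 else (c x.1)^-1.
have [|f fE] := @word_lift _ _ _ (@fg_barR X) (@fg_barL X) H c'.
  by move=> s t [[x []]]; rewrite /c' /= ?mulg1 ?mulgV ?mulVg.
by exists f => x; rewrite fE.
Qed.

Lemma free_group_lift_uniq (f g : {multiplicative free_group X -> H}) :
  (forall x, f (fg_gen x) = g (fg_gen x)) -> f =1 g.
Proof.
move=> fg; apply: word_lift_uniq => -[x []]; first exact: fg.
by rewrite -fg_genV !multV fg.
Qed.

End FreeGroupLift.

Section FreeProductLift.
Variables (V : Type) (G : V -> groupType).

Lemma fp_inM v : {morph @fp_in V G v : g h / g * h}.
Proof.
move=> g h; rewrite -[RHS]qclassM; apply/esym/qclassP/rst_step.
exists [::], [:: existT (fun v => G v : Type) v g; existT (fun v => G v : Type) v h],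
  [:: existT (fun v => G v : Type) v (g * h)], [::].
by split=> //; apply: (@fp_mul V G v).
Qed.

HB.instance Definition _ v :=
  isMultiplicative.Build (G v) (free_product G) (@fp_in V G v) (@fp_inM v).

Lemma free_product_lift (H : groupType) (c : forall v, {multiplicative G v -> H}) :
  exists f : {multiplicative free_product G -> H},
    forall v (g : G v), f (fp_in g) = c v g.
Proof.
pose c' (x : {v : V & G v}) := c (projT1 x) (projT2 x).
have [|f fE] := @word_lift _ _ _ (@fp_barR V G) (@fp_barL V G) H c'.
  by move=> s t [v|v g h]; rewrite /c' /= ?mulg1 ?mult1 ?gmulfM.
by exists f => v g; rewrite fE.
Qed.

Lemma free_product_lift_uniq (H : groupType)
    (f g : {multiplicative free_product G -> H}) :
  (forall v (x : G v), f (fp_in x) = g (fp_in x)) -> f =1 g.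
Proof. by move=> fg; apply: word_lift_uniq => -[v x]; apply: fg. Qed.

End FreeProductLift.

Definition gp_hom (V : Type) (adj : V -> V -> Prop) (G : V -> groupType) v :
  {multiplicative G v -> graph_product adj G} := nq_proj _ \o @fp_in V G v.

(* The universal property of the group generated by the family [a] subject to
   the relations [a x, a y] = 1 for [ind x y]. *)
Definition raag_over (X : Type) (ind : X -> X -> Prop) (G : groupType)
    (a : X -> G) : Prop :=
  [/\ forall x y, ind x y -> commute (a x) (a y),
      forall (H : groupType) (c : X -> H),
        (forall x y, ind x y -> commute (c x) (c y)) ->
        exists f : {multiplicative G -> H}, forall x, f (a x) = c x &
      forall (H : groupType) (f g : {multiplicative G -> H}),
        (forall x, f (a x) = g (a x)) -> f =1 g].

Lemma raag_over_iso (X : Type) (ind : X -> X -> Prop) (G H : groupType)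
    (a : X -> G) (b : X -> H) :
    raag_over ind a -> raag_over ind b ->
  exists f : {multiplicative G -> H}, bijective f /\ forall x, f (a x) = b x.
Proof.
move=> [ac aL aU] [bc bL bU].
have [f fE] := aL H b bc; have [g gE] := bL G a ac.
exists f; split=> //; exists g => x.
- by apply: (aU _ (g \o f) idfun) => z /=; rewrite fE gE.
- by apply: (bU _ (f \o g) idfun) => z /=; rewrite gE fE.
Qed.

Lemma presented_raag (X : Type) (ind : X -> X -> Prop) (R : set (free_group X)) :
    (forall r, R r <-> exists x y, ind x y /\ r = [~ fg_gen x, fg_gen y]) ->
  raag_over ind (pr_gen R).
Proof.
move=> RE; split=> [x y xy|H c cc|H f g fg].
- apply/commgP/eqP; rewrite /pr_gen -multR; apply: nq_proj_rel.
  by apply/RE; exists x, y.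
- have [F FE] := free_group_lift c.
  have [|f fE] := @nquot_lift _ H R F; last by exists f => x; rewrite fE.
  move=> r /RE[x [y [/cc/commgP/eqP xy ->]]].
  by rewrite multR !FE.
- move=> z; rewrite -[z]qreprK.
  exact: (@free_group_lift_uniq _ _ (f \o nq_proj R) (g \o nq_proj R)).
Qed.

Lemma commute_free_group (X : Type) (H : groupType)
    (f : {multiplicative free_group X -> H}) (h : H) :
  (forall x, commute h (f (fg_gen x))) -> forall g, commute h (f g).
Proof.
move=> fh g; rewrite -[g]qreprK; elim: (qrepr g) => [|[x b] s IH].
  by rewrite (@qclass1 (word_sgroup (@fg_barR X) (@fg_barL X))) mult1; apply: commute1.
rewrite (@qclassM (word_sgroup (@fg_barR X) (@fg_barL X)) [:: (x, b)] s) gmulfM.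
apply: commuteM IH; case: b; first exact: fh.
by rewrite -fg_genV multV; apply: commuteV.
Qed.

Lemma graph_product_raag (V : Type) (adj : V -> V -> Prop) (Y : V -> Type)
    (X : Type) (ind : X -> X -> Prop)
    (vert : X -> V) (idx : forall x, Y (vert x)) (mk : forall v, Y v -> X) :
    (forall v (y : Y v), existT Y _ (idx (mk v y)) = existT Y v y) ->
    (forall x, mk (vert x) (idx x) = x) ->
    (forall x y, ind x y <-> adj (vert x) (vert y)) ->
  raag_over ind
    (fun x => gp_in adj (G := fun v => free_group (Y v)) (fg_gen (idx x))).
Proof.
move=> mkK mkV indE; set G := fun v => free_group (Y v).
have gp_gen H (F : forall v, Y v -> H) v y : F _ (idx (mk v y)) = F v y.
  exact: (congr1 (fun z : {v & Y v} => F (projT1 z) (projT2 z)) (mkK v y)).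
split=> [x y /indE xy|H c cc|H f g fg].
- apply/commgP/eqP; rewrite /gp_in -multR; apply: nq_proj_rel.
  by exists (vert x), (vert y), (fg_gen (idx x)), (fg_gen (idx y)).
- pose F v := projT1 (cid (free_group_lift (fun y : Y v => c (mk v y)))).
  have FE v : forall y, F v (fg_gen y) = c (mk v y).
    exact: projT2 (cid (free_group_lift (fun y : Y v => c (mk v y)))).
  have [F' F'E] := free_product_lift F.
  have [|f fE] := @nquot_lift _ H (gp_commutators adj (G := G)) F'.
    move=> r [v [w [g [h [vw ->]]]]].
    rewrite multR !F'E; apply/eqP/commgP.
    apply: commute_free_group => y; apply: commute_sym.
    apply: commute_free_group => z; rewrite !FE; apply/commute_sym/cc/indE.
    have e := mkK v z; have e' := mkK w y.
    by rewrite (existT_inj1 e) (existT_inj1 e').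
  by exists f => x; rewrite fE F'E FE mkV.
- move=> z; rewrite -[z]qreprK.
  apply: (@free_product_lift_uniq _ _ _ (f \o nq_proj _) (g \o nq_proj _)) => v x /=.
  refine (@free_group_lift_uniq (Y v) H
    (f \o @gp_hom V adj G v) (g \o @gp_hom V adj G v) _ x) => y.
  have := fg (mk v y).
  by rewrite (gp_gen H (fun v y => f (gp_in adj (fg_gen y))))
             (gp_gen H (fun v y => g (gp_in adj (fg_gen y)))).
Qed.

(** * Paths, homotopies and liftings *)

Section EdgePaths.
Variable X : complex2.
Implicit Types (x y z : cV X) (s t d : seq (cE X)).

Lemma homot_null x r : null_loop r -> epath x r x -> homot x x r [::].
Proof.
move=> hr hx; apply: rst_sym; apply: rst_step; exists [::], r, [::].
split; rewrite /= ?cats0 //; split=> //; apply: epath_isVl hx.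
Qed.

Lemma epath_nil x s y : epath x s y -> epath x [::] x.
Proof. by move=> h; split=> //; apply: epath_isVl h. Qed.

Lemma homot_of_loop x y s t : epath x s y -> epath x t y ->
  homot x x (s ++ einv t) [::] -> homot x y s t.
Proof.
move=> hs ht h.
have h1 := homot_ctx hs (epath_nil (epath_inv hs)) (homot_invL ht).
have h2 := homot_ctx (epath_nil hs) ht h.
rewrite !cats0 in h1; rewrite /= -catA in h2.
exact: rst_trans (rst_sym _ _ _ _ h1) h2.
Qed.

Lemma homot_conj x y s t d : epath y d x -> homot y y s t ->
  homot x x (einv d ++ s ++ d) (einv d ++ t ++ d).
Proof. by move=> hd; apply: (homot_ctx (epath_inv hd) hd). Qed.

Lemma homot_conjP x y s d d' : epath y d x -> epath y s y -> homot y x d d' ->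
  homot x x (einv d ++ s ++ d) (einv d' ++ s ++ d').
Proof.
move=> hd hs dd'; have hd' := (homot_epath dd').1 hd.
apply: homot_cat (epath_inv hd') (epath_catI hs hd) (homot_inv hd dd') _.
exact: homot_cat hs hd (rst_refl _ _ _) dd'.
Qed.

Lemma homot_mul_inv x y z s t d : epath x s y -> epath z d y -> epath y t x ->
  homot x x (s ++ t) ((s ++ einv d) ++ d ++ t).
Proof.
move=> hs hd ht; apply: rst_sym.
by have := homot_ctx hs ht (homot_invL hd); rewrite /= -!catA.
Qed.

Section Represents.
Variables (x : cV X) (hx : isV x).
Implicit Types g h : pi1 hx.

Lemma represents_ex s : epath x s x -> exists g, @represents X x hx s g.
Proof. by move=> hs; exists (pi1_class hx (exist _ s hs)), hs. Qed.

Lemma represented_ex g : exists2 s, epath x s x & represents s g.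
Proof.
have := qreprK g; case: (qrepr g) => s hs <-.
by exists s => //; exists hs.
Qed.

Lemma represents_epath s g : represents s g -> epath x s x.
Proof. by case. Qed.

Lemma represents_eqP s t g h : represents s g -> represents t h ->
  g = h <-> homot x x s t.
Proof.
move=> [hs ->] [ht ->].
exact: (@qclassP (loop_sgroup hx) (exist _ s hs) (exist _ t ht)).
Qed.

Lemma represents_fun s g h : represents s g -> represents s h -> g = h.
Proof. by move=> sg sh; apply/(represents_eqP sg sh)/rst_refl. Qed.

Lemma represents_homot s t g : homot x x s t -> represents s g -> represents t g.
Proof.
move=> st sg; have ht := (homot_epath st).1 (represents_epath sg).
by have [h th] := represents_ex ht; rewrite (proj2 (represents_eqP sg th) st).
Qed.

Lemma represents_mul s t g h :
  represents s g -> represents t h -> represents (s ++ t) (g * h).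
Proof.
move=> [hs ->] [ht ->]; eexists.
exact: esym (@qclassM (loop_sgroup hx) (exist _ s hs : loop x) (exist _ t ht : loop x)).
Qed.

Lemma represents_inv s g : represents s g -> represents (einv s) g^-1.
Proof.
move=> [hs ->]; eexists.
exact: esym (@qclassV (loop_sgroup hx) (exist _ s hs : loop x)).
Qed.

Lemma represents_nil : @represents X x hx [::] 1.
Proof. by eexists. Qed.

End Represents.
End EdgePaths.

Lemma represents_map (X Y : complex2) (F : cmap X Y) x (hx : isV x)
    (y : cV Y) (hy : isV y) (Fxy : F x = y) s (g : pi1 hx) :
  represents s g -> represents (map_epath F s) (pi1_map hy Fxy g).
Proof.
move=> [hs ->]; rewrite pi1_map_class.
by eexists; congr pi1_class; apply: eq_exist.
Qed.

Section SqPaths.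
Variable K : dcomplex.
Implicit Types (q u v : seq (edge K)) (s : seq (triple K)).

Lemma walk_cell (x y : vertex K) u f v :
  walk x (u ++ top f ++ v) y -> walk x (u ++ bot f ++ v) y.
Proof.
move=> /walk_cat [z [hu /walk_cat [w [hf hv]]]].
apply/walk_cat; exists z; split=> //; apply/walk_cat; exists w; split=> //.
have [x' [y' [ht hb]]] := top_bot_walk f.
by have [-> ->] := walk_uniq (@top_neq0 _ f) hf ht.
Qed.

Lemma walk_bot (x y : vertex K) (t : triple K) :
  walk x (triple_top t) y -> walk x (triple_bot t) y.
Proof. by case: t => u f v; apply: walk_cell. Qed.

Lemma epath_walk (x y : vertex K) q s q' :
  @epath (Sq K) q s q' -> walk x q y -> walk x q' y.
Proof.
elim: s q => [|t s IH] q /=; first by case=> _ ->.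
by case=> _ <- /IH h /walk_bot; apply: h.
Qed.

Lemma null_loop_closed q r q' :
  @null_loop (Sq K) r -> @epath (Sq K) q r q' -> q' = q.
Proof.
case=> [[u f v]|{}r [u f w g v _]] /=.
  by rewrite /triple_bot /= bot_inv => -[_ <- [_ _ [_ <-]]].
move=> [_ <- [_ _ [_ _ [_ _ [_ <-]]]]].
by rewrite /triple_bot /triple_top /= bot_inv -!catA.
Qed.

Lemma sq_comm u f q g v : path1 (u ++ top f ++ q ++ top g ++ v) ->
  @homot (Sq K) (u ++ top f ++ q ++ top g ++ v) (u ++ bot f ++ q ++ bot g ++ v)
    [:: Triple u f (q ++ top g ++ v); Triple (u ++ bot f ++ q) g v]
    [:: Triple (u ++ top f ++ q) g v; Triple u f (q ++ bot g ++ v)].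
Proof.
move=> h.
have h1 : path1 (u ++ bot f ++ q ++ top g ++ v) by apply: path1_bot.
have h2 : path1 (u ++ top f ++ q ++ bot g ++ v).
  by have := @path1_bot K (u ++ top f ++ q) g v; rewrite -!catA; apply.
have h3 : path1 (u ++ bot f ++ q ++ bot g ++ v) by apply: path1_bot.
have hs : @epath (Sq K) (u ++ top f ++ q ++ top g ++ v)
    [:: Triple u f (q ++ top g ++ v); Triple (u ++ bot f ++ q) g v]
    (u ++ bot f ++ q ++ bot g ++ v).
  by rewrite /= /triple_top /triple_bot /= -!catA.
have ht : @epath (Sq K) (u ++ top f ++ q ++ top g ++ v)
    [:: Triple (u ++ top f ++ q) g v; Triple u f (q ++ bot g ++ v)]
    (u ++ bot f ++ q ++ bot g ++ v).
  by rewrite /= /triple_top /triple_bot /= -!catA.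
apply: (homot_of_loop hs ht); apply: homot_null.
  by apply: null_face; apply: Sq_face.
exact: epath_catI hs (epath_inv ht).
Qed.

End SqPaths.

Lemma map_catI (A B : Type) (f : A -> B) s u v : map f s = u ++ v ->
  exists s1 s2, [/\ s = s1 ++ s2, map f s1 = u & map f s2 = v].
Proof.
move=> h; exists (take (size u) s), (drop (size u) s).
by rewrite cat_take_drop map_take map_drop h take_size_cat ?drop_size_cat.
Qed.

Lemma cons_inj (A : Type) (a b : A) (s t : seq A) :
  a :: s = b :: t -> a = b /\ s = t.
Proof. by case. Qed.

Lemma cat_inj_size (A : Type) (s1 s2 t1 t2 : seq A) :
  size s1 = size t1 -> s1 ++ s2 = t1 ++ t2 -> s1 = t1 /\ s2 = t2.
Proof.
elim: s1 t1 => [|a s1 IH] [|b t1] //= [/IH {}IH] [-> /IH [-> ->]] //.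
Qed.

Lemma map_epathE (K L : dcomplex) (phi : dmap K L) s :
  map_epath (Sq_map phi) s = map (map_triple phi) s.
Proof. by elim: s => //= t s <-. Qed.

Section Lifting.
Variables (L M : dcomplex) (phi : dmap L M) (x y : vertex L).
Hypothesis cover : forall q, walk x q y ->
  set_bij (applicable q) (applicable (map phi q)) (map_triple phi).
Implicit Types (q : seq (edge L)) (s t : seq (triple L)).

Lemma lift_inj (t1 t2 : triple L) : walk x (triple_top t1) y ->
  triple_top t1 = triple_top t2 -> map_triple phi t1 = map_triple phi t2 ->
  t1 = t2.
Proof.
move=> hw e12; have [_ inj _] := cover hw.
by apply: inj; rewrite inE /applicable.
Qed.

Lemma lift_path q (s : seq (triple M)) p : walk x q y ->
    @epath (Sq M) (map phi q) s p ->
  exists st qt, [/\ @epath (Sq L) q st qt, map (map_triple phi) st = s &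
    map phi qt = p].
Proof.
elim: s q => [|e s IH] q hq /=.
  move=> [[hne _] <-]; exists [::], q; split=> //; split=> //.
  by split; [case: q hne {hq} | exists x, y].
move=> [he etop hs]; have [_ _ surj] := cover hq.
have [t /= tq et] := surj e etop; rewrite /applicable /= in tq.
rewrite -tq in hq.
have hbot : walk x (triple_bot t) y by apply: walk_bot.
have hs' : @epath (Sq M) (map phi (triple_bot t)) s p.
  by rewrite -map_triple_bot et.
have [st [qt [h1 h2 h3]]] := IH _ hbot hs'.
exists (t :: st), qt; split=> //=; last by rewrite et h2.
split=> //; split; last by exists x, y.
by case: (t) => u f v; rewrite /triple_top /=; case: u => //=; case: (top f) (@top_neq0 _ f).
Qed.

Lemma lift_path_uniq q s1 s2 q1 q2 : walk x q y ->
    @epath (Sq L) q s1 q1 -> @epath (Sq L) q s2 q2 ->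
    map (map_triple phi) s1 = map (map_triple phi) s2 ->
  s1 = s2.
Proof.
elim: s1 q s2 => [|t1 s1 IH] q [|t2 s2] //= hq [_ e1 h1] [_ e2 h2] [el ec er] es.
have ht : t1 = t2 by apply: lift_inj; rewrite ?e1 ?e2 // /map_triple el ec er.
subst t2; rewrite (IH (triple_bot t1) s2) //.
by apply: walk_bot; rewrite e1.
Qed.

Lemma lift_null q r qt : walk x q y -> @epath (Sq L) q r qt ->
  @null_loop (Sq M) (map (map_triple phi) r) -> @null_loop (Sq L) r.
Proof.
move=> hq hr; move e: (map _ r) => r' hnull.
case: hnull e => [e|_ [u f w g v _]]; case: r hr => [|t1 [|t2 r]] //=.
  case: r => // -[h1 e1 [_ e2 _]] et.
  have [et1 et'] := cons_inj et; have [et2 _] := cons_inj et'.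
  suff -> : t2 = triple_inv t1 by exact: (@null_backtrack (Sq L) t1).
  apply: lift_inj; first by rewrite e2; apply: walk_bot; rewrite e1.
    by rewrite e2 /triple_top /= top_inv.
  by rewrite et2 -et1 /map_triple /triple_inv /= mapc_inv.
case: r => [|t3 [|t4 []]] // [h1 e1 [_ e2 [_ e3 [_ e4 _]]]] et.
have [et1 et'] := cons_inj et; have [et2 et''] := cons_inj et'.
have [et3 et'''] := cons_inj et''; have [et4 _] := cons_inj et'''.
clear et et' et'' et'''.
have {}e3 : triple_top t3 = triple_bot t2 := e3.
have {}e4 : triple_top t4 = triple_bot t3 := e4.
have w2 : walk x (triple_top t2) y by rewrite e2; apply: walk_bot; rewrite e1.
have w3 : walk x (triple_top t3) y by rewrite e3; apply: walk_bot.
have w4 : walk x (triple_top t4) y by rewrite e4; apply: walk_bot.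
case: t1 h1 e1 e2 et1 => ut ft xt h1 e1 e2 [mu mf] /map_catI [wt [gv [ex mw]]].
move=> /map_catI [gt [vt [egv mg mv]]]; rewrite {}egv in ex; subst xt.
case: t2 w2 e2 e3 et2 => u2 f2 v2 w2 e2 e3 [mu2 mf2 mv2].
have e : u2 ++ (top f2 ++ v2) = (ut ++ bot ft ++ wt) ++ (gt ++ vt).
  by rewrite -!catA; apply: e2.
have [|eu2 /cat_inj_size []] := cat_inj_size _ e.
  by rewrite -(size_map phi u2) mu2 -mf -mw -mu mapc_bot !size_cat !size_map.
  by rewrite -(size_map phi gt) mg -mf2 mapc_top size_map.
move=> egt ev2.
subst u2 v2 gt.
have e3' : t3 = triple_inv (Triple ut ft (wt ++ bot f2 ++ vt)).
  apply: lift_inj => //.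
    by rewrite e3 /triple_top /triple_bot /= top_inv -!catA.
  by rewrite et3 /map_triple /triple_inv /= !map_cat mapc_inv -mapc_bot mu mf mw mf2 mv.
have e4' : t4 = triple_inv (Triple (ut ++ top ft ++ wt) f2 vt).
  apply: lift_inj => //.
    by rewrite e4 e3' /triple_top /triple_bot /= top_inv bot_inv -!catA.
  by rewrite et4 /map_triple /triple_inv /= !map_cat mapc_inv -mapc_top mu mf mw mf2 mv.
rewrite e3' e4'; apply: null_face; exact: Sq_face.
Qed.

Let lifts (q1 : seq (edge M)) (s s' : seq (triple M)) := forall q st q', walk x q y -> map phi q = q1 ->
  @epath (Sq L) q st q' -> map (map_triple phi) st = s ->
  exists st', [/\ @epath (Sq L) q st' q', map (map_triple phi) st' = s' &
    @homot (Sq L) q q' st st'].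

Lemma lift_homot (q1 q2 : seq (edge M)) (s s' : seq (triple M)) :
  @homot (Sq M) q1 q2 s s' -> lifts q1 s s'.
Proof.
suff h : @homot (Sq M) q1 q2 s s' -> lifts q1 s s' /\ lifts q1 s' s.
  by case/h.
elim=> [{}s {}s'|{}s|{}s {}s' _ [] //|{}s {}s' s'' _ [h1 h2] _ [h3 h4]].
- move=> [a [r [b [hr -> -> _ hs]]]]; split=> q st q' hq eq hst.
  + move=> /map_catI [at_ [bt [est mat_ mbt]]]; subst st.
    have /epath_cat [z [ha hb]] := hst.
    move: hs => /epath_cat [z' [ha']] /epath_cat [z'' [hrz _]].
    have ez : map phi z = z'.
      have := map_epathP (Sq_map phi) ha; rewrite map_epathE mat_ /= eq => k.
      exact: epath_tgt_uniq k ha'.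
    rewrite -ez in hrz.
    have hz := epath_walk ha hq.
    have [rt [z2 [hrt mrt mz2]]] := lift_path hz hrz.
    have hnull : @null_loop (Sq L) rt by apply: lift_null hz hrt _; rewrite mrt.
    have ez2 := null_loop_closed hnull hrt; subst z2.
    have hst' := epath_catI ha (epath_catI hrt hb).
    exists (at_ ++ rt ++ bt); split=> //; first by rewrite !map_cat mat_ mrt mbt.
    by apply: rst_step; exists at_, rt, bt.
  + move=> /map_catI [at_ [w [est mat_ /map_catI [rt [bt [ew mrt mbt]]]]]].
    subst st w.
    have /epath_cat [z [ha /epath_cat [z2 [hrt hb]]]] := hst.
    have hnull : @null_loop (Sq L) rt.
      by apply: lift_null (epath_walk ha hq) hrt _; rewrite mrt.
    have ez2 := null_loop_closed hnull hrt; subst z2.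
    have hst' := epath_catI ha hb.
    exists (at_ ++ bt); split=> //; first by rewrite map_cat mat_ mbt.
    by apply: rst_sym; apply: rst_step; exists at_, rt, bt.
- by split=> q st q' _ _ hst est; exists st; split=> //; apply: rst_refl.
- split=> q st q' hq eq hst est.
  + have [st' [k1 k2 k3]] := h1 _ _ _ hq eq hst est.
    have [st'' [k4 k5 k6]] := h3 _ _ _ hq eq k1 k2.
    by exists st''; split=> //; apply: rst_trans k3 k6.
  + have [st' [k1 k2 k3]] := h4 _ _ _ hq eq hst est.
    have [st'' [k4 k5 k6]] := h2 _ _ _ hq eq k1 k2.
    by exists st''; split=> //; apply: rst_trans k3 k6.
Qed.

Lemma homot_lift q s1 s2 q1 q2 p : walk x q y ->
    @epath (Sq L) q s1 q1 -> @epath (Sq L) q s2 q2 ->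
    @homot (Sq M) (map phi q) p (map (map_triple phi) s1) (map (map_triple phi) s2) ->
  q1 = q2 /\ @homot (Sq L) q q1 s1 s2.
Proof.
move=> hq h1 h2 /lift_homot /(_ _ _ _ hq erefl h1 erefl) [s2' [h2' e h12]].
have e2 := lift_path_uniq hq h2' h2 e; subst s2'.
by split=> //; apply: epath_tgt_uniq h2' h2.
Qed.

End Lifting.

Section ExpansionMap.
Variables (K Kt : dcomplex) (I : edge K -> Type) (phi : dmap Kt K).
Let J (e : edge Kt) := I (phi e).

Definition exp_mapc (f : cell (expansion J)) : cell (expansion I) :=
  match f with
  | inl f => inl (mapc phi f)
  | inr (existT e i, b) => inr (existT I (phi e) i, b)
  end.

Definition exp_map : dmap (expansion J) (expansion I).
Proof.
refine (@DMap (expansion J) (expansion I) (mapv phi) (mape phi) exp_mapc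
  (@mape_ini _ _ phi) (@mape_ter _ _ phi) _ _ _ _).
- by case=> [f|[[e i] b]] //; exact: (mapc_top phi f).
- by case=> [f|[[e i] b]] //; exact: (mapc_bot phi f).
- by case=> [f|[[e i] b]] //=; rewrite mapc_inv.
- by case=> [f|[[e i] b]] //=; exact: (mapc_positive phi f).
Defined.

Lemma walk_expansion (L : dcomplex) (Z : edge L -> Type) (x y : vertex L) s :
  @walk (expansion Z) x s y <-> @walk L x s y.
Proof. by elim: s x => //= e s IH x; rewrite IH. Qed.

Lemma exp_map_cover (x y : vertex Kt) :
    (forall q, walk x q y ->
      set_bij (applicable q) (applicable (map phi q)) (map_triple phi)) ->
  forall q, @walk (expansion J) x q y ->
    set_bij (@applicable (expansion J) q)
      (@applicable (expansion I) (map exp_map q)) (map_triple exp_map).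
Proof.
move=> cover q /walk_expansion hq; have [_ inj surj] := cover q hq; split.
- by move=> t /= tq; rewrite /applicable /= (map_triple_top exp_map) tq.
- move=> [u1 f1 v1] [u2 f2 v2]; rewrite !inE /applicable /triple_top /=.
  move=> e1 e2 [eu ef ev].
  have su : size u1 = size u2 by rewrite -(size_map phi u1) eu size_map.
  case: f1 f2 e1 e2 ef => [f1|[[x1 i1] b1]] [f2|[[x2 i2] b2]] //= e1 e2 [].
    move=> ef; suff [-> -> ->] : @Triple Kt u1 f1 v1 = @Triple Kt u2 f2 v2 by [].
    by apply: inj; rewrite ?inE // /map_triple /= eu ef ev.
  move=> ex ei <-; rewrite -e2 in e1.
  have [-> [ex12 ->]] := cat_inj_size su e1; subst x2.
  by have -> := @existT_inj2 {classic edge K} I (phi x1) i1 i2 ei.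
- move=> [u [f|[[e i] b]] v] /= h.
    have [[ut ft vt] /= h1 h2] := surj (@Triple K u f v) h.
    exists (@Triple (expansion J) ut (inl ft) vt) => //.
    by case: h2 => <- <- <-.
  move: (esym h); rewrite /triple_top /=.
  move=> /map_catI [ut [w [-> mu]]]; case: w => [|et vt] //= [ee mv].
  subst e; exists (@Triple (expansion J) ut (inr (existT J et i, b)) vt) => //.
  by rewrite /map_triple /= mu mv.
Qed.

Lemma exp_map_incl s :
  map (map_triple exp_map) (map (map_triple (exp_incl J)) s) =
  map (map_triple (exp_incl I)) (map (map_triple phi) s).
Proof.
rewrite -!map_comp; apply: eq_map => -[u f v].
by rewrite /map_triple /= !map_id.
Qed.

Lemma retraction_exp_map s :
  map_epath (retraction I) (map (map_triple exp_map) s) =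
  map (map_triple phi) (map_epath (retraction J) s).
Proof.
elim: s => //= -[u f v] s IH; rewrite /map_epath /= map_cat -IH; congr (_ ++ _).
by case: f => [f|[[e i] b]].
Qed.

Lemma exp_map_leaf_conj q' e (i : I (phi e)) q'' d :
  map (map_triple exp_map) (@leaf_conj Kt J q' e i q'' d) =
  leaf_conj (map phi q') i (map phi q'') (map (map_triple phi) d).
Proof.
rewrite /leaf_conj !map_epathE !map_cat exp_map_incl -exp_map_incl.
congr (_ ++ _); rewrite /einv map_rev -!map_comp; congr rev.
by apply: eq_map => t /=; rewrite /map_triple /= mapc_inv.
Qed.

End ExpansionMap.

(** * Expansions of rooted 2-trees *)

Lemma einv_map_epath (X Y : complex2) (F : cmap X Y) s :
  map_epath F (einv s) = einv (map_epath F s).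
Proof.
elim: s => // e s IH.
rewrite einv_cons map_epath_cat IH /map_epath /= cats0 mapE_inv.
by rewrite -/(map_epath F s) einv_cat.
Qed.

Lemma homotopic_epath (K : dcomplex) (s t : seq (edge K)) :
  path1 t -> homotopic s t -> exists d, @epath (Sq K) s d t.
Proof. by move=> ht [->|//]; exists [::]. Qed.

Section InExpansion.
Variables (M : dcomplex) (J : edge M -> Type).
Let E := expansion J.
Let inc (d : seq (triple M)) : seq (triple E) := map_epath (Sq_map (exp_incl J)) d.

Lemma inc_path q d q' : @epath (Sq M) q d q' -> @epath (Sq E) q (inc d) q'.
Proof. by move=> /(map_epathP (Sq_map (exp_incl J))); rewrite /= !map_id. Qed.

Lemma inc_homot q q' d d' :
  @homot (Sq M) q q' d d' -> @homot (Sq E) q q' (inc d) (inc d').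
Proof. by move=> /(map_homot (Sq_map (exp_incl J))); rewrite /= !map_id. Qed.

Lemma inc_seq1 u f v : inc [:: Triple u f v] = [:: @Triple E u (inl f) v].
Proof. by rewrite /inc /map_epath /= /map_triple /= !map_id. Qed.

(* The loops of the leaf [i] at the 1-paths [s ++ e :: v] and [s' ++ e :: v']
   are freely homotopic along a path over [M]. *)
Definition slide e (i : J e) (s v s' v' : seq (edge M)) : Prop :=
  exists D, @epath (Sq M) (s ++ e :: v) D (s' ++ e :: v') /\
    @homot (Sq E) (s ++ e :: v) (s' ++ e :: v')
      (@Triple E s (leaf i) v :: inc D) (inc D ++ [:: @Triple E s' (leaf i) v']).

Lemma leaf_loop e (i : J e) s v : path1 (s ++ e :: v) ->
  @epath (Sq E) (s ++ e :: v) [:: @Triple E s (leaf i) v] (s ++ e :: v).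
Proof. by []. Qed.

Lemma slide_refl e (i : J e) s v : path1 (s ++ e :: v) -> slide i s v s v.
Proof. by move=> h; exists [::]; split=> //; apply: rst_refl. Qed.

Lemma slide_trans e (i : J e) s v s1 v1 s2 v2 :
  slide i s v s1 v1 -> slide i s1 v1 s2 v2 -> slide i s v s2 v2.
Proof.
move=> [D1 [h1 k1]] [D2 [h2 k2]]; exists (D1 ++ D2).
split; first exact: epath_catI h1 h2.
rewrite /inc map_epath_cat -/(inc D1) -/(inc D2).
have h0 := epath_isVl h1; have h0' := epath_isVl (epath_inv h2).
apply: (rst_trans _ _ _ (inc D1 ++ (@Triple E s1 (leaf i) v1 :: inc D2))).
  have := homot_ctx (x := (s ++ e :: v : cV (Sq E))) (c := [::]) (conj h0 erefl) (inc_path h2) k1.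
  by rewrite /= -catA.
have := homot_ctx (inc_path h1) (d := [::]) (w := (s2 ++ e :: v2 : cV (Sq E))) (conj h0' erefl) k2.
by rewrite !cats0 -catA.
Qed.

Lemma slide_cell_left e (i : J e) u f t v :
  path1 (u ++ top f ++ t ++ e :: v) ->
  slide i (u ++ top f ++ t) v (u ++ bot f ++ t) v.
Proof.
move=> h; exists [:: Triple u f (t ++ e :: v)].
have h' := path1_bot h; split; first by rewrite -!catA.
apply: rst_sym; have := @sq_comm E u (inl f) t (leaf i) v h.
by rewrite inc_seq1 -!catA.
Qed.

Lemma slide_cell_right e (i : J e) s u f t :
  path1 (s ++ e :: u ++ top f ++ t) ->
  slide i s (u ++ top f ++ t) s (u ++ bot f ++ t).
Proof.
move=> h; exists [:: Triple (s ++ e :: u) f t].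
have h' : path1 (s ++ e :: u ++ bot f ++ t).
  by have := @path1_bot M (s ++ e :: u) f t; rewrite -!catA; apply.
split; first by rewrite /= /triple_top /triple_bot /= -!catA.
have := @sq_comm E s (leaf i) u (inl f) t h.
by rewrite inc_seq1.
Qed.

Lemma slide_left e (i : J e) s d s' v :
  @epath (Sq M) s d s' -> path1 (s ++ e :: v) -> slide i s v s' v.
Proof.
elim: d s => [|[u f t] d IH] s /=; first by move=> [_ <-]; apply: slide_refl.
move=> [_ <- hd] h; rewrite /triple_top /= -!catA in h *.
apply: slide_trans (slide_cell_left i h) (IH _ hd _).
by rewrite -!catA; apply: path1_bot.
Qed.

Lemma slide_right e (i : J e) s v d v' :
  @epath (Sq M) v d v' -> path1 (s ++ e :: v) -> slide i s v s v'.
Proof.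
elim: d v => [|[u f t] d IH] v /=; first by move=> [_ <-]; apply: slide_refl.
move=> [_ <- hd] h; rewrite /triple_top /= in h *.
apply: slide_trans (slide_cell_right i h) (IH _ hd _).
by have := @path1_bot M (s ++ e :: u) f t; rewrite -!catA; apply.
Qed.

Section Emission.
Variables (H : groupType) (c : {e : edge M & J e} -> H).

Definition leaf_val (t : triple E) : H :=
  match tc t with
  | inl _ => 1
  | inr (l, b) => if b then c l else (c l)^-1
  end.

Lemma leaf_val_inv t : leaf_val (triple_inv t) = (leaf_val t)^-1.
Proof. by case: t => u [f|[l []]] v; rewrite /leaf_val /= ?invg1 ?invgK. Qed.

Lemma word_prod_inc d : word_prod leaf_val (inc d) = 1.
Proof. by rewrite /inc map_epathE; elim: d => //= t d ->; rewrite mulg1. Qed.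

Hypothesis c_comm : forall x y u q v,
  path1 (u ++ projT1 x :: q ++ projT1 y :: v) -> commute (c x) (c y).

Lemma word_prod_homot q q' s t :
  @homot (Sq E) q q' s t -> word_prod leaf_val s = word_prod leaf_val t.
Proof.
elim=> [{}s {}t|//|{}s {}t _ -> //|{}s {}t r _ -> _ -> //].
move=> [a [r [b [hr -> -> _ _]]]]; rewrite !word_prod_cat.
suff -> : word_prod leaf_val r = 1 by rewrite mul1g.
case: hr => [e|_ [u f w g v h]] /=; first by rewrite leaf_val_inv mulg1 mulgV.
have fg : commute (leaf_val (@Triple E u f (w ++ top g ++ v)))
    (leaf_val (@Triple E (u ++ bot f ++ w) g v)).
  case: f g h => [f|[k1 b1]] [g|[k2 b2]] //= h; rewrite /leaf_val /=.
  - exact/commute_sym/commute1.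
  - exact: commute1.
  - have k12 := c_comm h.
    case: b1 b2 => [] []; do ?[exact: k12 | apply: commuteV | apply: commute_sym].
rewrite !leaf_val_inv mulg1 mulgA fg.
by rewrite /leaf_val /= mulgA mulgK mulgV.
Qed.

End Emission.
End InExpansion.

Section Tree.
Variables (M : dcomplex) (w : seq (edge M)) (hw : path1 w).
Hypothesis tree : rooted_2tree w.
Variables (J : edge M -> Type).
Let E := expansion J.
Let inc (d : seq (triple M)) : seq (triple E) := map_epath (Sq_map (exp_incl J)) d.

Lemma tree_simply_connected q d d' : @epath (Sq M) q d w -> @epath (Sq M) q d' w ->
  @homot (Sq M) q w d d'.
Proof.
move=> hd hd'.
have [g hg] := represents_ex (X := Sq M) hw (epath_catI (epath_inv hd') hd).
have g1 : g = 1 by have [hw' [_ _ +]] := tree; rewrite (Prop_irrelevance hw' hw); apply.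
have /(represents_eqP hg) := g1; move=> /(_ _ (represents_nil _)) h.
have h1 := homot_ctx hd' (epath_nil (epath_inv hd)) h.
have h2 := homot_ctx (epath_nil hd) hd (homot_invR hd').
rewrite !cats0 in h1; rewrite /= -!catA in h2.
exact: rst_trans (rst_sym _ _ _ _ h2) h1.
Qed.

Lemma tree_acyclic x e q : ~ @walk M x (e :: q) x.
Proof.
have [_ [_ t2 _]] := tree.
move=> hq; have [//|[d hd]] := t2 _ _ _ [::] hq erefl.
by have [] := epath_isVl (epath_inv hd).
Qed.

Lemma tree_walk (x y x' y' : vertex M) s : walk x w y -> walk x' s y' ->
  exists s1 s2, walk x (s1 ++ s ++ s2) y.
Proof.
have [_ [t1 _ _]] := tree.
move=> xy hs; have [s1 [_ [h1 _]]] := t1 x' _ _ xy.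
have [_ [s2 [_ h2]]] := t1 y' _ _ xy.
exists s1, s2; apply/walk_cat; exists x'; split=> //.
by apply/walk_cat; exists y'.
Qed.

Lemma tree_root (x y : vertex M) s : walk x w y -> walk x s y ->
  exists d, @epath (Sq M) s d w.
Proof.
move=> xy hs; have [_ [_ t2 _]] := tree.
by apply: homotopic_epath (t2 _ _ _ _ hs xy).
Qed.

Lemma path1_independent u e1 q e2 v :
  path1 (u ++ e1 :: q ++ e2 :: v) -> independent w e1 e2.
Proof.
move=> [_ [x' [y' hs]]]; have [_ [x [y xy]]] := hw; split.
  move=> e12; subst e2; move: hs => /walk_cat [z [_ [_ /walk_cat [z' [hq [hz' _]]]]]].
  by apply: (@tree_acyclic z' e1 q); split.
have [s1 [s2 hw']] := tree_walk xy hs.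
have [_ [_ t2 _]] := tree.
exists (s1 ++ (u ++ e1 :: q ++ e2 :: v) ++ s2); split; first exact: t2 hw' xy.
- by apply/List.in_or_app; right; apply/List.in_or_app; left;
     apply/List.in_or_app; right; left.
- by apply/List.in_or_app; right; apply/List.in_or_app; left;
     apply/List.in_or_app; right; right; apply/List.in_or_app; right; left.
Qed.

Lemma tree_edge e : exists q' q'' d, @epath (Sq M) (q' ++ e :: q'') d w.
Proof.
have [_ [x [y xy]]] := hw.
have [s1 [s2 hs]] := @tree_walk x y (ini e) (ter e) [:: e] xy (conj erefl erefl).
by have [d hd] := tree_root xy hs; exists s1, s2, d.
Qed.

Lemma tree_slide e (i : J e) q' q'' d r' r'' d' :
  @epath (Sq M) (q' ++ e :: q'') d w -> @epath (Sq M) (r' ++ e :: r'') d' w ->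
  slide i q' q'' r' r''.
Proof.
move=> hd hd'; have [_ [x [y xy]]] := hw; have [_ [_ t2 _]] := tree.
have hq := epath_walk (epath_inv hd) xy; have hr := epath_walk (epath_inv hd') xy.
have hpq := epath_isVl hd; have hpr := epath_isVl hd'.
have /walk_cat [z [hq' [ez hq'']]] := hq; have /walk_cat [z' [hr' [ez' hr'']]] := hr.
subst z z'.
have hpm : path1 (r' ++ e :: q'').
  split; first by case: (r').
  by exists x, y; apply/walk_cat; exists (ini e).
apply: (@slide_trans _ _ _ _ _ _ r' q'').
  have [->|[D hD]] := t2 _ _ _ _ hq' hr'; first exact: slide_refl.
  exact: slide_left hD hpq.
have [->|[D hD]] := t2 _ _ _ _ hq'' hr''; first exact: slide_refl.
exact: slide_right hD hpm.
Qed.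

Lemma leaf_conj_path e (i : J e) q' q'' d : @epath (Sq M) (q' ++ e :: q'') d w ->
  @epath (Sq E) w (leaf_conj q' i q'' d) w.
Proof.
move=> hd; have hd' := inc_path J hd.
apply: epath_catI (epath_inv hd') (epath_catI _ hd').
exact/leaf_loop/(epath_isVl hd).
Qed.

Lemma leaf_conj_homot e (i : J e) q' q'' d r' r'' d' :
  @epath (Sq M) (q' ++ e :: q'') d w -> @epath (Sq M) (r' ++ e :: r'') d' w ->
  @homot (Sq E) w w (leaf_conj q' i q'' d) (leaf_conj r' i r'' d').
Proof.
move=> hd hd'; have [D [hD hs]] := tree_slide i hd hd'.
have hq := leaf_loop i (epath_isVl hd); have hr := leaf_loop i (epath_isVl hd').
have dDd' := inc_homot J (tree_simply_connected hd (epath_catI hD hd')).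
apply: rst_trans (homot_conjP (inc_path J hd) hq dDd') _.
rewrite map_epath_cat einv_cat -catA; set D' := map_epath _ D.
have hD' : @epath (Sq E) _ D' _ := inc_path J hD.
rewrite [einv D' ++ _](_ : _ = (einv D' ++ (@Triple E q' (leaf i) q'' :: D')) ++
  map_epath (Sq_map (exp_incl J)) d'); last by rewrite -catA.
apply: homot_conj (inc_path J hd') _.
apply: (rst_trans _ _ _ (einv D' ++ D' ++ [:: @Triple E r' (leaf i) r''])).
  have := homot_ctx (epath_inv hD') (epath_nil hr) hs.
  by rewrite !cats0.
have := homot_ctx (epath_nil hr) hr (homot_invL hD').
by rewrite /= -!catA.
Qed.

Lemma leaf_class e (i : J e) : exists g : Dexp J hw, forall q' q'' d,
  @epath (Sq M) (q' ++ e :: q'') d w ->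
  @represents (Sq E) w hw (leaf_conj q' i q'' d) g.
Proof.
have [q' [q'' [d hd]]] := tree_edge e.
have [g hg] := represents_ex (X := Sq E) hw (leaf_conj_path i hd).
exists g => r' r'' d' hd'.
exact: represents_homot (leaf_conj_homot i hd hd') hg.
Qed.

Section Universal.
Variable b : forall e, J e -> Dexp J hw.
Hypothesis bE : forall e (i : J e) q' q'' d,
  @epath (Sq M) (q' ++ e :: q'') d w ->
  @represents (Sq E) w hw (leaf_conj q' i q'' d) (b i).

Lemma leaf_comm u e1 (i1 : J e1) q e2 (i2 : J e2) v d :
  @epath (Sq M) (u ++ e1 :: q ++ e2 :: v) d w -> commute (b i1) (b i2).
Proof.
move=> hd; have hp := epath_isVl hd.
have hd2 : @epath (Sq M) ((u ++ e1 :: q) ++ e2 :: v) d w by rewrite -catA.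
have r1 := bE i1 hd; have r2 := bE i2 hd2.
have r12 := represents_mul r1 r2; have r21 := represents_mul r2 r1.
apply/(represents_eqP r12 r21).
have hd' := inc_path J hd; have hi := epath_inv hd'.
have h1 := leaf_loop i1 hp.
have hp2 : path1 ((u ++ e1 :: q) ++ e2 :: v) by rewrite -catA.
have h2 := leaf_loop i2 hp2; rewrite -catA in h2.
have k12 := homot_mul_inv (epath_catI hi h1) hi (epath_catI h2 hd').
have k21 := homot_mul_inv (epath_catI hi h2) hi (epath_catI h1 hd').
rewrite einvK -!catA in k12 k21; rewrite /leaf_conj -!catA.
apply: rst_trans (rst_sym _ _ _ _ k12) (rst_trans _ _ _ _ _ _ k21).
exact: (homot_conj hd' (@sq_comm E u (leaf i1) q (leaf i2) v hp)).
Qed.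

Lemma leaf_gen (H : groupType) (f g : {multiplicative Dexp J hw -> H}) :
    (forall e (i : J e), f (b i) = g (b i)) ->
  forall s q1 q2 d1 d2 z,
    @epath (Sq E) q1 s q2 -> @epath (Sq M) q1 d1 w -> @epath (Sq M) q2 d2 w ->
    @represents (Sq E) w hw (@einv (Sq E) (inc d1) ++ s ++ inc d2) z -> f z = g z.
Proof.
move=> fg; elim=> [|t s IH] q1 q2 d1 d2 z /=.
  move=> [_ <-] hd1 hd2 hz.
  have h : @homot (Sq E) w w (@einv (Sq E) (inc d1) ++ inc d2) [::].
    have h1 := inc_homot J (tree_simply_connected hd2 hd1).
    apply: rst_trans (homot_cat _ _ (rst_refl _ _ _) h1) _.
    - exact: (epath_inv (inc_path J hd1)).
    - exact: (inc_path J hd2).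
    - exact: (homot_invL (inc_path J hd1)).
  have -> : z = 1 by apply/(represents_eqP hz (represents_nil _)).
  by rewrite !mult1.
case: t => u [c|[[e i] sg]] v; rewrite /triple_top /triple_bot /=.
  move=> [hq1 eq1 hs] hd1 hd2 hz; subst q1.
  have ht : @epath (Sq M) (u ++ bot c ++ v) [:: triple_inv (@Triple M u c v)] (u ++ top c ++ v).
    apply: (@epath_inv (Sq M) (u ++ top c ++ v) [:: @Triple M u c v]).
    by split=> //; split=> //; apply: (@path1_bot M).
  apply: (IH _ _ _ _ z hs (epath_catI ht hd1) hd2).
  rewrite /inc map_epath_cat einv_cat -catA.
  by rewrite inc_seq1 /einv /= /triple_inv /= cell_invK.
move=> [hq1 eq1 hs] hd1 hd2 hz; subst q1.
have hd1' := inc_path J hd1.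
pose T := @Triple E u (inr (existT J e i, sg)) v.
have hT : @epath (Sq E) (u ++ e :: v) [:: T] (u ++ e :: v) by [].
have [z1 hz1] := represents_ex (X := Sq E) hw
  (epath_catI (epath_inv hd1') (epath_catI hT hd1')).
have [z2 hz2] := represents_ex (X := Sq E) hw
  (epath_catI (epath_inv hd1') (epath_catI hs (inc_path J hd2))).
have -> : z = z1 * z2.
  apply/(represents_eqP hz (represents_mul hz1 hz2)).
  have := homot_mul_inv (epath_catI (epath_inv hd1') hT) (epath_inv hd1')
    (epath_catI hs (inc_path J hd2)).
  by rewrite einvK -!catA.
rewrite !gmulfM (IH _ _ _ _ _ hs hd1 hd2 hz2); congr (_ * _).
have rb := bE i hd1; clear hz; case: sg @T hT hz1 => T hT hz1.
  by rewrite (represents_fun hz1 rb) fg.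
suff -> : z1 = (b i)^-1 by rewrite !multV fg.
apply: (represents_fun hz1); have := represents_inv rb.
by rewrite /leaf_conj !einv_cat einvK -!catA.
Qed.

Lemma tree_raag : raag_over
  (fun x y : {e : edge M & J e} => independent w (projT1 x) (projT1 y))
  (fun x => b (projT2 x)).
Proof.
split=> [[e1 i1] [e2 i2] [/= ne [s [hs in1 in2]]]|H c cc|H f g fg z].
- have [d hd] := homotopic_epath hw hs.
  have [u [v es]] := List.in_split _ _ in1; subst s.
  have [in2'|[/ne//|in2']] := List.in_app_or _ _ _ in2.
  + have [u1 [u2 eu]] := List.in_split _ _ in2'; subst u.
    have {}hd : @epath (Sq M) ((u1 ++ e2 :: u2) ++ e1 :: v) d w := hd.
    by rewrite -catA in hd; apply: commute_sym (leaf_comm i2 i1 hd).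
  + have [v1 [v2 ev]] := List.in_split _ _ in2'; subst v.
    exact: (leaf_comm i1 i2 hd).
- have cc' x y u q v : path1 (u ++ projT1 x :: q ++ projT1 y :: v) ->
      commute (c x) (c y) by move=> /path1_independent /cc.
  have [||f fE] := @quot_lift (@loop_sgroup (Sq E) w hw) H
      (fun l => word_prod (leaf_val c) (sval l)).
  + by move=> s t; apply: word_prod_homot.
  + by move=> s t; apply: word_prod_cat.
  exists f => -[e i]; have [q' [q'' [d hd]]] := tree_edge e.
  have [h ->] := bE i hd; rewrite fE /= !word_prod_cat word_prod_inc.
  by rewrite -einv_map_epath word_prod_inc mul1g mulg1 /= mulg1.
- have [s hs rs] := represented_ex z.
  have h0 : @epath (Sq M) w [::] w by split.
  apply: (leaf_gen _ hs h0 h0); last by rewrite cats0; exact: rs.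
  by move=> e i; apply: (fg (existT J e i)).
Qed.

End Universal.
End Tree.

(** * The kernel of the retraction *)

Section CoverKernel.
Variables (K Kt : dcomplex) (I : edge K -> Type) (phi : dmap Kt K).
Variables (pt : seq (edge Kt)) (hpt : path1 pt) (hp : path1 (map phi pt)).
Variables (x y : vertex Kt) (xy : walk x pt y).
Hypothesis tree : rooted_2tree pt.
Hypothesis cover : forall q, walk x q y ->
  set_bij (applicable q) (applicable (map phi q)) (map_triple phi).
Let J (e : edge Kt) := I (phi e).

Definition cover_hom : {multiplicative Dexp J hpt -> Dexp I hp} :=
  @pi1_map (Sq (expansion J)) (Sq (expansion I)) (Sq_map (exp_map I phi))
    pt hpt (map phi pt) hp erefl.

Lemma cover_hom_represents s (g : Dexp J hpt) :
  @represents (Sq (expansion J)) pt hpt s g ->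
  @represents (Sq (expansion I)) _ hp (map (map_triple (exp_map I phi)) s) (cover_hom g).
Proof.
move=> /(represents_map (F := Sq_map (exp_map I phi)) hp erefl).
by rewrite map_epathE.
Qed.

Let xyE : @walk (expansion J) x pt y.
Proof. by apply/walk_expansion. Qed.

Lemma cover_hom_inj : injective cover_hom.
Proof.
apply: mult_inj => g; have [s hs rs] := represented_ex g.
move=> g1; apply/(represents_eqP rs (represents_nil _)).
have h0 : @epath (Sq (expansion J)) pt [::] pt by split.
have rs' := cover_hom_represents rs.
have h : @homot (Sq (expansion I)) (map phi pt) (map phi pt)
    (map (map_triple (exp_map I phi)) s) [::].
  by apply/(represents_eqP rs' (represents_nil _)).
by have [] := homot_lift (exp_map_cover (I := I) cover) xyE hs h0 h.
Qed.

Lemma cover_hom_range : range cover_hom = kernel (theta I hp).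
Proof.
have thE s g : @represents (Sq (expansion I)) _ hp s g ->
    @represents (Sq K) _ hp (map_epath (retraction I) s) (theta I hp g).
  exact: represents_map.
have h0 : @epath (Sq Kt) pt [::] pt by split.
apply/seteqP; split=> [_ [g _ <-]|g].
  have [s hs rs] := represented_ex g.
  have := thE _ _ (cover_hom_represents rs); rewrite retraction_exp_map => r1.
  apply/(represents_eqP r1 (represents_nil _)).
  have hs' : @epath (Sq Kt) pt (map_epath (retraction J) s) pt.
    exact: (map_epathP (retraction J) hs).
  have := map_homot (Sq_map phi) (tree_simply_connected hpt tree hs' h0).
  by rewrite map_epathE.
rewrite /kernel /= => g1; have [s hs rs] := represented_ex g.
have [st [q [hst est eq]]] := lift_path (exp_map_cover (I := I) cover) xyE hs.
have r1 := thE _ _ rs.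
have h : @homot (Sq K) (map phi pt) (map phi pt)
    (map (map_triple phi) (map_epath (retraction J) st)) [::].
  rewrite -retraction_exp_map est.
  by apply/(represents_eqP r1 (represents_nil _)).
have hst' : @epath (Sq Kt) pt (map_epath (retraction J) st) q.
  exact: (map_epathP (retraction J) hst).
have [eqp _] := homot_lift cover xy hst' h0 h; subst q.
have [gt rt] := represents_ex (X := Sq (expansion J)) hpt hst.
exists gt => //; apply: (represents_fun (cover_hom_represents rt)).
by rewrite est.
Qed.

End CoverKernel.

Lemma isom_onto_comp (G H L : groupType) (f : {multiplicative G -> H})
    (F : {multiplicative H -> L}) (A : set L) :
  bijective f -> isom_onto F A -> isom_onto (F \o f) A.
Proof.
move=> [f' fK f'K] [Finj <-]; split.
  by move=> z1 z2 /Finj /(can_inj fK).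
apply/seteqP; split=> [_ [z _ <-]|_ [z _ <-]]; first by exists (f z).
by exists (f' z) => //=; rewrite f'K.
Qed.

Lemma leaf_conj_cast (K : dcomplex) (I : edge K -> Type) e e' (he : e = e')
    (i : I e) q' q'' d :
  leaf_conj q' (eq_rect e I i e' he) q'' d = leaf_conj q' i q'' d.
Proof. by case: _ / he. Qed.

Lemma leaf_conj_catr (K : dcomplex) (I : edge K -> Type) e (i : I e) q' q'' d d' :
  leaf_conj q' i q'' (d ++ d') =
  @einv (Sq (expansion I)) (map_epath (Sq_map (exp_incl I)) d')
    ++ leaf_conj q' i q'' d ++ map_epath (Sq_map (exp_incl I)) d'.
Proof. by rewrite /leaf_conj !map_epath_cat einv_cat -!catA. Qed.

Theorem theorem3p3 (K : dcomplex) (p : seq (edge K)) (hp : path1 p)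
    (I : edge K -> Type) (Kt : dcomplex) (phi : dmap Kt K)
    (pt : seq (edge Kt)) (hcov : universal_cover phi pt p) :
  exists a : forall et : edge Kt, I (phi et) -> Dexp I hp,
  [/\
    exists Phi : {multiplicative
        graph_product (@ind_adj Kt pt)
          (fun v : ind_vertex pt => free_group (I (phi (sval v))))
        -> Dexp I hp},
      isom_onto Phi (kernel (theta I hp)) /\
      (forall (v : ind_vertex pt) (i : I (phi (sval v))),
         Phi (gp_in (@ind_adj Kt pt) (v := v) (fg_gen i)) = a (sval v) i),
    let gen := {et : edge Kt & I (phi et)} in
    let x et (i : I (phi et)) : gen := existT (fun et => I (phi et)) et i in
    let rels := [set r : free_group gen |
      exists et1 et2 (i1 : I (phi et1)) (i2 : I (phi et2)),
        independent pt et1 et2 /\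
        r = [~ fg_gen (x et1 i1), fg_gen (x et2 i2)]]%classic in
    exists Psi : {multiplicative presented rels -> Dexp I hp},
      isom_onto Psi (kernel (theta I hp)) /\
      (forall et (i : I (phi et)), Psi (pr_gen rels (x et i)) = a et i),
    forall (et : edge Kt) (i : I (phi et)),
      (exists qt' qt'' delta, @epath (Sq Kt) (qt' ++ et :: qt'') delta pt) /\
      (forall qt' qt'' delta, @epath (Sq Kt) (qt' ++ et :: qt'') delta pt ->
         @represents (Sq (expansion I)) p hp
           (leaf_conj (map phi qt') i (map phi qt'')
              (map_epath (Sq_map phi) delta))
           (a et i)) &
    forall (et : edge Kt) (i : I (phi et)) qt' qt'' delta
        (g : diagram_group hp) (gamma : seq (triple K)),
      @epath (Sq Kt) (qt' ++ et :: qt'') delta pt ->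
      @represents (Sq K) p hp gamma g ->
      let lift := is_lift phi pt p (map phi (qt' ++ et :: qt''))
        (map_epath (Sq_map phi) delta ++ gamma) in
      (exists rt deltab, lift rt deltab) /\
      (forall rt deltab, lift rt deltab ->
        exists qb' eb qb'' (he : phi et = phi eb),
          let ib := eq_rect (phi et) I i (phi eb) he in
          [/\ rt = qb' ++ eb :: qb'',
              map phi qb' = map phi qt',
              map phi qb'' = map phi qt'',
              (incl_exp I hp g)^-1 * a et i * incl_exp I hp g = a eb ib &
              @represents (Sq (expansion I)) p hp
                (leaf_conj (map phi qt') i (map phi qt'')
                   (map_epath (Sq_map phi) deltab))
                (a eb ib)])].
Proof.
case: (hcov) => tree ept cover0; subst p.
have hpt : path1 pt by case: tree.
have [_ [x [y xy]]] := hpt.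
have cover q : walk x q y -> _ := cover0 x y q xy.
pose J et := I (phi et).
pose b et (i : J et) := projT1 (cid (leaf_class hpt tree i)).
have bE et (i : J et) q' q'' d : @epath (Sq Kt) (q' ++ et :: q'') d pt ->
    @represents (Sq (expansion J)) pt hpt (leaf_conj q' i q'' d) (b et i).
  exact: (projT2 (cid (leaf_class hpt tree i))).
have raag := tree_raag tree bE.
pose F := @cover_hom K Kt I phi pt hpt hp.
have F_onto : isom_onto F (kernel (theta I hp)).
  by split; [apply: cover_hom_inj xy cover | apply: cover_hom_range xy tree cover].
pose a et (i : J et) := F (b et i).
have aE et (i : J et) q' q'' d : @epath (Sq Kt) (q' ++ et :: q'') d pt ->
    @represents (Sq (expansion I)) (map phi pt) hp
      (leaf_conj (map phi q') i (map phi q'') (map_epath (Sq_map phi) d)) (a et i).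
  move=> hd; have := cover_hom_represents hp (bE et i q' q'' d hd).
  by rewrite exp_map_leaf_conj map_epathE.
have vert et : exists s, homotopic s pt /\ List.In et s.
  have [q' [q'' [d hd]]] := tree_edge hpt tree et.
  exists (q' ++ et :: q''); split; first by right; exists d.
  by apply/List.in_or_app; right; left.
exists a; split.
- have gp := @graph_product_raag (ind_vertex pt) (@ind_adj Kt pt)
    (fun v => J (sval v)) {et : edge Kt & J et}
    (fun x y => independent pt (projT1 x) (projT1 y))
    (fun x => exist _ (projT1 x) (vert (projT1 x))) (fun x => projT2 x)
    (fun v i => existT J (sval v) i).
  have [|||f [fbij fE]] := raag_over_iso (gp _ _ _) raag.
  + move=> [et h] i /=; by rewrite (Prop_irrelevance h (vert et)).
  + by case.
  + by [].
  exists (F \o f); split; first exact: isom_onto_comp.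
  move=> [et h] i; rewrite (Prop_irrelevance h (vert et)) /=.
  by have /= -> := fE (existT J et i).
- move=> gen g rels.
  have [|f [fbij fE]] := raag_over_iso (@presented_raag gen
    (fun x y => independent pt (projT1 x) (projT1 y)) rels _) raag.
    move=> r; split=> [[e1 [e2 [i1 [i2 [h ->]]]]]|[[e1 i1] [[e2 i2] [h ->]]]].
      by exists (g e1 i1), (g e2 i2).
    by exists e1, e2, i1, i2.
  exists (F \o f); split; first exact: isom_onto_comp.
  by move=> et i; rewrite /= fE.
- move=> et i; split; first exact: tree_edge.
  by move=> q' q'' d; apply: aE.
- move=> et i q' q'' d g gamma hd rg lift.
  have hgamma := represents_epath rg.
  have hd' := map_epathP (Sq_map phi) hd.
  have hdg := epath_catI hd' hgamma; split.
    have [st [rt [h1 h2 h3]]] := lift_path cover xy (epath_inv hdg).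
    exists rt, (@einv (Sq Kt) st); split=> //; first exact: epath_inv.
    by rewrite einv_map_epath map_epathE h2 einvK; apply: rst_refl.
  move=> rt db [hdb ert hom].
  move: ert; rewrite map_cat => /map_catI [qb' [w [ert eqb']]].
  case: w ert => [|eb qb''] //= ert [eeb eqb'']; subst rt.
  exists qb', eb, qb'', (esym eeb); set ib := eq_rect _ _ _ _ _.
  have rb : @represents (Sq (expansion I)) (map phi pt) hp
      (leaf_conj (map phi q') i (map phi q'') (map_epath (Sq_map phi) db)) (a eb ib).
    by have := aE eb ib _ _ _ hdb; rewrite eqb' eqb'' leaf_conj_cast.
  split=> //.
  have rg' := represents_map (F := Sq_map (exp_incl I)) (x := map phi pt) hp (map_id _) rg.
  have := represents_mul (represents_mul (represents_inv rg') (aE et i _ _ _ hd)) rg'.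
  rewrite -catA -leaf_conj_catr => rc; apply/(represents_eqP rc rb).
  have hd2 := inc_path I hdg.
  apply: rst_sym; rewrite /leaf_conj.
  apply: (@homot_conjP (Sq (expansion I)) _ (map phi q' ++ phi et :: map phi q'')).
  + apply: inc_path; move: hdg => /(homot_epath hom).2.
    by rewrite map_cat.
  + apply: leaf_loop; have := epath_isVl hdg; by rewrite /= map_cat.
  + by apply: inc_homot; move: hom; rewrite map_cat.
Qed.
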